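(* Let $R>0$ and let $f : B(0,R) \to \mathbb{H}$ be a regular function. If $f$ is not constant on any 2-sphere $x+y\mathbb{S}\subseteq B(0,R)$ with $x,y\in\mathbb{R}$, $y\neq 0$, then $f$ is open, i.e. it maps open subsets of $B(0,R)$ onto open subsets of $\mathbb{H}$.
   Context: $\mathbb{H}$ is the skew field of real quaternions, with the usual norm $|\cdot|$, and $B(0,R)=\{q\in\mathbb{H}:|q|<R\}$. Let $\mathbb{S}=\{q\in\mathbb{H}:q^2=-1\}$ be the 2-sphere of imaginary units and, for $I\in\mathbb{S}$, let $L_I=\mathbb{R}+I\mathbb{R}$. A real differentiable function $f:\Omega\to\mathbb{H}$ on a domain $\Omega\subseteq\mathbb{H}$ is called regular (Cullen-regular) if for every $I\in\mathbb{S}$ the restriction $f_I$ of $f$ to $\Omega\cap L_I$ satisfies $\frac12\left(\frac{\partial}{\partial x}+I\frac{\partial}{\partial y}\right)f_I(x+Iy)=0$ at every point $x+Iy$ of $\Omega\cap L_I$ ($x,y\in\mathbb{R}$). For $x,y\in\mathbb{R}$ write $x+y\mathbb{S}=\{x+yI:I\in\mathbb{S}\}$. *)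

(* Defs.v *)
From Stdlib Require Export Reals Lra.
From Coquelicot Require Export Coquelicot.
Open Scope R_scope.

(* (a, b, c, d) stands for a + b i + c j + d k.  As an iterated product, H
   inherits from Coquelicot its additive group, its real scalar multiplication,
   its topology and its structure of real normed module. *)
Definition H : Type := (R * R * R * R)%type.

Definition RtoH (x : R) : H := (x, 0, 0, 0).

Definition Hmult (p q : H) : H :=
  let '(a1, b1, c1, d1) := p in
  let '(a2, b2, c2, d2) := q in
  (a1 * a2 - b1 * b2 - c1 * c2 - d1 * d2,
   a1 * b2 + b1 * a2 + c1 * d2 - d1 * c2,
   a1 * c2 - b1 * d2 + c1 * a2 + d1 * b2,
   a1 * d2 + b1 * c2 - c1 * b2 + d1 * a2).

Definition Hmod (q : H) : R :=
  let '(a, b, c, d) := q in sqrt (a ^ 2 + b ^ 2 + c ^ 2 + d ^ 2).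

Lemma Hmod_norm (q : H) : Hmod q = norm (K := R_AbsRing) q.
Proof.
destruct q as [[[a b] c] d].
change (norm (K := R_AbsRing) ((a, b, c, d) : H)) with
  (sqrt (sqrt (sqrt (Rabs a ^ 2 + Rabs b ^ 2) ^ 2 + Rabs c ^ 2) ^ 2
         + Rabs d ^ 2)).
unfold Hmod.
rewrite <- !Rsqr_pow2, <- !Rsqr_abs, !Rsqr_sqrt; auto.
all: unfold Rsqr; nra.
Qed.

Definition Hball (r : R) (q : H) : Prop := Hmod q < r.

Definition imag_unit (I : H) : Prop := Hmult I I = RtoH (-1).

(* The point x + y I. *)
Definition slice_pt (I : H) (x y : R) : H :=
  plus (RtoH x) (scal (K := R_AbsRing) y I).

Definition sphere (x y : R) (q : H) : Prop :=
  exists I : H, imag_unit I /\ q = slice_pt I x y.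

(* A function on an open set Omega is encoded by a total function: only its
   values on Omega matter below, derivatives being local.  The partial
   derivatives dx and dy exist as soon as f is real differentiable, so that
   asserting their existence is not an extra condition. *)
Definition regular_on (Omega : H -> Prop) (f : H -> H) : Prop :=
  (forall q : H, Omega q -> ex_filterdiff (K := R_AbsRing) f (locally q)) /\
  (forall (I : H) (x y : R), imag_unit I -> Omega (slice_pt I x y) ->
     exists dx dy : H,
       is_derive (K := R_AbsRing) (fun t : R => f (slice_pt I t y)) x dx /\
       is_derive (K := R_AbsRing) (fun t : R => f (slice_pt I x t)) y dy /\
       scal (K := R_AbsRing) (1 / 2) (plus dx (Hmult I dy)) = RtoH 0).

Definition constant_on (A : H -> Prop) (f : H -> H) : Prop :=
  exists c : H, forall q : H, A q -> f q = c.

Definition image (f : H -> H) (U : H -> Prop) (w : H) : Prop :=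
  exists q : H, U q /\ f q = w.

(* Main.v *)
Require Import Defs.
From Stdlib Require Import Reals Lra Lia ClassicalEpsilon.
From Coquelicot Require Import Coquelicot.
Open Scope R_scope.

(** Why the theorem holds. On each sphere x + yS a regular function is affine in the
    imaginary unit: f (x + yI) = b + I c, where b and c are functions of x and y with
    values in H such that F = b + i c, with values in the complexification of H, is
    holomorphic in x + iy ([slice_formula]). Call a value w. By elementary algebra, the
    equation b - w + I c = 0 has a solution I among the imaginary units if and only if
    b - w and c are orthogonal of equal length, that is, if and only if the complex
    number |b - w|^2 - |c|^2 + 2 i <b - w, c> is zero ([norm_form_of_root],
    [root_of_norm_form]). This number is the sum of the squares of the four coordinates
    of F - w, hence a holomorphic function of x + iy; it is the symmetrization of f - w.

    Now let f (x0 + y0 I0) = w0. The symmetrization of f - w0 vanishes at z0 = x0 + i y0,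
    and not identically near z0: otherwise it would vanish on the whole disc, in particular
    on the real axis, where it equals |f - w0|^2, so that f would be constant
    ([symmetrization_not_vanishing]). Its zero at z0 is therefore isolated, and for w close
    to w0 the symmetrization of f - w still has a zero z close to z0, by the minimum
    modulus principle ([zero_in_disc]). So f takes the value w at x + yI for some I. If
    y0 = 0 this point is close to x0 whatever I is. If y0 is not 0, then c is not 0 at z0,
    because f is not constant on the sphere of z0, and I = (w - b) c^-1 is close to I0 by
    continuity ([nearby_preimage]). Either way w is a value of f near x0 + y0 I0.

    Complex analysis is needed for functions that are differentiable at every point,
    without continuity of the derivative. The closed differential form
    - i h(z) dz / (z - a), pulled back along the contraction of a circle to the inner point
    a, is integrated around rectangles with Goursat's bisection argument ([Goursat]). This
    gives Cauchy's formula ([Cauchy_difference]), then Taylor expansions with remainder, and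
    from these the isolation of zeros, the identity theorem and the maximum modulus
    principle. The slice formula comes from the identity theorem, applied to the complex
    coordinates of f on the slices of I and of i, which share the real axis. *)

(** * Curve integrals in C and Goursat's theorem on rectangles *)

(** Complex numbers carry two structures of normed module; integrals and continuity
    of curves in C are taken for the one over the real scalars. *)
Definition CInt (f : R -> C) (a b : R) : C :=
  RInt (V := C_R_CompleteNormedModule) f a b.

Definition Ccont (f : R -> C) (t : R) : Prop :=
  continuous (U := C_R_CompleteNormedModule) f t.

Lemma scal_C (a : R) (z : C) : scal (V := C_R_NormedModule) a z = (a * z)%C.
Proof.
destruct z as [u v]; unfold scal; cbn; unfold prod_scal, scal, Cmult; cbn.
unfold mult; cbn; f_equal; ring.
Qed.

Lemma Ccont_eps (f : R -> C) (t : R) :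
  (forall eps, 0 < eps -> exists delta, 0 < delta /\
     forall t', Rabs (t' - t) < delta -> Cmod (f t' - f t) < eps) ->
  Ccont f t.
Proof.
intros h; apply filterlim_locally; intros eps.
destruct (h eps (cond_pos eps)) as (d & dpos & hd).
exists (mkposreal d dpos); intros t' ht'.
apply (norm_compat1 (V := C_R_NormedModule)).
change (norm (minus (f t') (f t))) with
  (norm (V := prod_NormedModule R_AbsRing R_NormedModule R_NormedModule)
     (Cminus (f t') (f t))).
rewrite <- Cmod_norm; apply hd, ht'.
Qed.

Lemma ex_CInt (f : R -> C) (a b : R) :
  a <= b -> (forall t, a <= t <= b -> Ccont f t) ->
  ex_RInt (V := C_R_CompleteNormedModule) f a b.
Proof.
intros ab h; apply ex_RInt_continuous; intros t.
rewrite Rmin_left, Rmax_right by auto; exact (h t).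
Qed.

Lemma Ccont_minus (f g : R -> C) (t : R) :
  Ccont f t -> Ccont g t -> Ccont (fun t => f t - g t)%C t.
Proof. exact (continuous_minus (V := C_R_NormedModule) f g t). Qed.

Lemma CInt_Chasles (f : R -> C) (a b c : R) :
  a <= b <= c -> (forall t, a <= t <= c -> Ccont f t) ->
  CInt f a c = (CInt f a b + CInt f b c)%C.
Proof.
intros [ab bc] h; symmetry.
apply (RInt_Chasles (V := C_R_CompleteNormedModule)); apply ex_CInt; auto;
  intros t ht; apply h; lra.
Qed.

Lemma CInt_minus (f g : R -> C) (a b : R) :
  a <= b -> (forall t, a <= t <= b -> Ccont f t) ->
  (forall t, a <= t <= b -> Ccont g t) ->
  CInt (fun t => f t - g t)%C a b = (CInt f a b - CInt g a b)%C.
Proof.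
intros ab hf hg.
apply (RInt_minus (V := C_R_CompleteNormedModule)); apply ex_CInt; auto.
Qed.

Lemma CInt_ext (f g : R -> C) (a b : R) :
  a <= b -> (forall t, a <= t <= b -> f t = g t) -> CInt f a b = CInt g a b.
Proof.
intros ab h; apply (RInt_ext (V := C_R_CompleteNormedModule)); intros t; rewrite Rmin_left, Rmax_right; auto.
intros ht; apply h; lra.
Qed.

Lemma CInt_bound (f : R -> C) (a b M : R) :
  a <= b -> (forall t, a <= t <= b -> Ccont f t) ->
  (forall t, a <= t <= b -> Cmod (f t) <= M) ->
  Cmod (CInt f a b) <= (b - a) * M.
Proof.
intros ab hc hM; rewrite Cmod_norm.
apply (norm_RInt_le_const (V := C_R_NormedModule) f a b); auto.
- intros t ht; specialize (hM t ht); rewrite Cmod_norm in hM; exact hM.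
- apply (RInt_correct (V := C_R_CompleteNormedModule)), ex_CInt; auto.
Qed.

Lemma CInt_const (c : C) (a b : R) : CInt (fun _ => c) a b = ((b - a)%R * c)%C.
Proof.
rewrite <- scal_C; apply (RInt_const (V := C_R_CompleteNormedModule)).
Qed.

Lemma Ccont_const (c : C) (t : R) : Ccont (fun _ => c) t.
Proof. apply continuous_const. Qed.

Lemma CInt_near_const (f : R -> C) (c : C) (a b M : R) :
  a <= b -> (forall t, a <= t <= b -> Ccont f t) ->
  (forall t, a <= t <= b -> Cmod (f t - c) <= M) ->
  Cmod (CInt f a b - (b - a)%R * c) <= (b - a) * M.
Proof.
intros ab hc hM; rewrite <- CInt_const, <- CInt_minus; auto.
- apply CInt_bound; auto; intros t ht; apply Ccont_minus; auto.
  apply Ccont_const.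
- intros; apply Ccont_const.
Qed.

(** Frechet differentiability at one point, with A and B the partial derivatives.
    Continuity of the partial derivatives is never assumed: a regular function is only
    known to be differentiable at each point. *)
Definition total_diff (P : R -> R -> C) (x y : R) (A B : C) : Prop :=
  forall eps, 0 < eps -> exists delta, 0 < delta /\
    forall x' y', Rabs (x' - x) < delta -> Rabs (y' - y) < delta ->
      Cmod (P x' y' - P x y - ((x' - x)%R * A + (y' - y)%R * B))
        <= eps * (Rabs (x' - x) + Rabs (y' - y)).

Lemma total_diff_lipschitz P x y A B : total_diff P x y A B ->
  exists k delta, 0 < k /\ 0 < delta /\
    forall x' y', Rabs (x' - x) < delta -> Rabs (y' - y) < delta ->
      Cmod (P x' y' - P x y) <= k * (Rabs (x' - x) + Rabs (y' - y)).
Proof.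
intros h; destruct (h 1 Rlt_0_1) as (d & dpos & hd).
exists (1 + Cmod A + Cmod B), d.
pose proof (Cmod_ge_0 A); pose proof (Cmod_ge_0 B).
split; [lra | split; [lra |]]; intros x' y' hx hy; specialize (hd x' y' hx hy).
replace (P x' y' - P x y)%C with
  ((P x' y' - P x y - ((x' - x)%R * A + (y' - y)%R * B))
   + ((x' - x)%R * A + (y' - y)%R * B))%C by ring.
eapply Rle_trans; [apply Cmod_triangle |].
assert (h1 := Cmod_triangle ((x' - x)%R * A) ((y' - y)%R * B)).
rewrite !Cmod_mult, !Cmod_R in h1.
pose proof (Rabs_pos (x' - x)); pose proof (Rabs_pos (y' - y)); nra.
Qed.

Lemma total_diff_Ccont_fst P x y A B :
  total_diff P x y A B -> Ccont (fun t => P t y) x.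
Proof.
intros h; destruct (total_diff_lipschitz _ _ _ _ _ h) as (k & d & k0 & d0 & hk).
apply Ccont_eps; intros eps e0; exists (Rmin d (eps / k)); split.
{ apply Rmin_pos; auto; apply Rdiv_lt_0_compat; auto. }
intros t ht; assert (h1 := Rmin_l d (eps / k)); assert (h2 := Rmin_r d (eps / k)).
eapply Rle_lt_trans; [apply hk; [lra |] |];
  rewrite Rminus_eq_0, Rabs_R0; try lra.
rewrite Rplus_0_r; apply (Rlt_le_trans _ (k * (eps / k))).
- apply Rmult_lt_compat_l; lra.
- right; field; lra.
Qed.

Lemma total_diff_swap P x y A B :
  total_diff P x y A B -> total_diff (fun y x => P x y) y x B A.
Proof.
intros h eps e0; destruct (h eps e0) as (d & d0 & hd); exists d; split; auto.
intros y' x' hy hx; rewrite Cplus_comm, (Rplus_comm (Rabs _)); auto.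
Qed.

Lemma total_diff_Ccont_snd P x y A B :
  total_diff P x y A B -> Ccont (fun t => P x t) y.
Proof.
intros h; exact (total_diff_Ccont_fst _ _ _ _ _ (total_diff_swap _ _ _ _ _ h)).
Qed.

Lemma nested_intervals_point (u : nat -> R) (l : R) : 0 <= l ->
  (forall n, u n <= u (S n) <= u n + l / 2 ^ S n) ->
  exists x, forall n, u n <= x <= u n + l / 2 ^ n.
Proof.
intros hl hu.
assert (upper : forall n, u (S n) + l / 2 ^ S n <= u n + l / 2 ^ n).
{ intros n; replace (l / 2 ^ n) with (l / 2 ^ S n + l / 2 ^ S n);
    [specialize (hu n); lra |].
  assert (0 < 2 ^ n) by (apply pow_lt; lra); cbn; field; lra. }
assert (incr : forall n k, u n <= u (n + k)%nat).
{ intros n k; induction k; [rewrite Nat.add_0_r; lra |].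
  rewrite Nat.add_succ_r; specialize (hu (n + k)%nat); lra. }
assert (decr : forall n k, u (n + k)%nat + l / 2 ^ (n + k) <= u n + l / 2 ^ n).
{ intros n k; induction k; [rewrite Nat.add_0_r; lra |].
  rewrite Nat.add_succ_r; specialize (upper (n + k)%nat); lra. }
assert (cross : forall m n, u m <= u n + l / 2 ^ n).
{ intros m n.
  specialize (incr m n); specialize (decr n m); rewrite (Nat.add_comm n m) in decr.
  assert (0 < / 2 ^ (m + n)) by (apply Rinv_0_lt_compat, pow_lt; lra).
  assert (0 <= l / 2 ^ (m + n)) by (unfold Rdiv; nra); lra. }
destruct (completeness (fun x => exists n, x = u n)) as [x [ub lub]].
- exists (u 0%nat + l / 2 ^ 0); intros y [n ->]; apply cross.
- exists (u 0%nat), 0%nat; reflexivity.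
- exists x; intros n; split; [apply ub; exists n; reflexivity |].
  apply lub; intros y [m ->]; apply cross.
Qed.

Section Green.

Variables P Q : R -> R -> C.

(** The integral of P dx + Q dy around the boundary of a rectangle, with opposite
    sides already grouped. *)
Definition circulation (a b c d : R) : C :=
  (CInt (fun x => P x c - P x d) a b + CInt (fun y => Q b y - Q a y) c d)%C.

Variables a0 b0 c0 d0 : R.
Hypothesis closed_form : forall x y, a0 <= x <= b0 -> c0 <= y <= d0 ->
  exists A B D, total_diff P x y A B /\ total_diff Q x y B D.

Lemma P_cont x y : a0 <= x <= b0 -> c0 <= y <= d0 -> Ccont (fun t => P t y) x.
Proof.
intros hx hy; destruct (closed_form x y hx hy) as (A & B & D & hP & hQ).
exact (total_diff_Ccont_fst _ _ _ _ _ hP).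
Qed.

Lemma Q_cont x y : a0 <= x <= b0 -> c0 <= y <= d0 -> Ccont (fun t => Q x t) y.
Proof.
intros hx hy; destruct (closed_form x y hx hy) as (A & B & D & hP & hQ).
exact (total_diff_Ccont_snd _ _ _ _ _ hQ).
Qed.

Lemma circulation_split_x a m b c d :
  a0 <= a -> a <= m <= b -> b <= b0 -> c0 <= c -> c <= d -> d <= d0 ->
  circulation a b c d = (circulation a m c d + circulation m b c d)%C.
Proof.
intros ha hm hb hc hcd hd; unfold circulation.
rewrite (CInt_Chasles _ a m b); [| lra |].
2: intros t ht; apply Ccont_minus; apply P_cont; lra.
rewrite !(CInt_minus (fun y => Q _ y) (fun y => Q _ y)); try lra;
  try (intros t ht; apply Q_cont; lra).
ring.
Qed.

Lemma circulation_split_y a b c m d :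
  a0 <= a -> a <= b -> b <= b0 -> c0 <= c -> c <= m <= d -> d <= d0 ->
  circulation a b c d = (circulation a b c m + circulation a b m d)%C.
Proof.
intros ha hm hb hc hcd hd; unfold circulation.
rewrite (CInt_Chasles _ c m d); [| lra |].
2: intros t ht; apply Ccont_minus; apply Q_cont; lra.
rewrite !(CInt_minus (fun y => P y _) (fun y => P y _)); try lra;
  try (intros t ht; apply P_cont; lra).
ring.
Qed.

(** At a point of differentiability the affine parts of P and Q contribute nothing,
    because the cross derivatives agree; what is left is small with respect to the
    square of the size of the rectangle. It matters that the rectangle contains the
    point, since the error is measured from there. *)
Lemma circulation_small x y : a0 <= x <= b0 -> c0 <= y <= d0 ->
  forall eps, 0 < eps -> exists delta, 0 < delta /\
    forall a b c d, a0 <= a <= x -> x <= b <= b0 -> c0 <= c <= y -> y <= d <= d0 ->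
      b - a < delta -> d - c < delta ->
      Cmod (circulation a b c d) <= eps * (b - a + (d - c)) ^ 2.
Proof.
intros hx hy eps e0.
destruct (closed_form x y hx hy) as (A & B & D & hP & hQ).
destruct (hP (eps / 2) ltac:(lra)) as (d1 & d1pos & hd1).
destruct (hQ (eps / 2) ltac:(lra)) as (d2 & d2pos & hd2).
exists (Rmin d1 d2); split; [apply Rmin_pos; auto |].
intros a b c d ha hb hc hd hba hdc.
assert (m1 := Rmin_l d1 d2); assert (m2 := Rmin_r d1 d2).
set (L := b - a + (d - c)).
assert (near : forall u v, a <= u <= b -> c <= v <= d ->
   Rabs (u - x) < Rmin d1 d2 /\ Rabs (v - y) < Rmin d1 d2 /\
   Rabs (u - x) + Rabs (v - y) <= L).
{ intros u v hu hv; unfold L; split; [| split]; unfold Rabs;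
    repeat destruct Rcase_abs; lra. }
assert (estP : Cmod (CInt (fun x => P x c - P x d)%C a b
                 - (b - a)%R * ((c - d)%R * B)) <= (b - a) * (eps * L)).
{ apply CInt_near_const; [lra | |]; intros t ht.
  { apply Ccont_minus; apply P_cont; lra. }
  destruct (near t c) as (n1 & n2 & n3); [lra | lra |].
  destruct (near t d) as (n4 & n5 & n6); [lra | lra |].
  assert (e1 := hd1 t c ltac:(lra) ltac:(lra)).
  assert (e2 := hd1 t d ltac:(lra) ltac:(lra)).
  replace (P t c - P t d - (c - d)%R * B)%C with
    ((P t c - P x y - ((t - x)%R * A + (c - y)%R * B))
     + - (P t d - P x y - ((t - x)%R * A + (d - y)%R * B)))%C
    by (rewrite !RtoC_minus; ring).
  eapply Rle_trans; [apply Cmod_triangle |]; rewrite Cmod_opp; nra. }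
assert (estQ : Cmod (CInt (fun y => Q b y - Q a y)%C c d
                 - (d - c)%R * ((b - a)%R * B)) <= (d - c) * (eps * L)).
{ apply CInt_near_const; [lra | |]; intros t ht.
  { apply Ccont_minus; apply Q_cont; lra. }
  destruct (near b t) as (n1 & n2 & n3); [lra | lra |].
  destruct (near a t) as (n4 & n5 & n6); [lra | lra |].
  assert (e1 := hd2 b t ltac:(lra) ltac:(lra)).
  assert (e2 := hd2 a t ltac:(lra) ltac:(lra)).
  replace (Q b t - Q a t - (b - a)%R * B)%C with
    ((Q b t - Q x y - ((b - x)%R * B + (t - y)%R * D))
     + - (Q a t - Q x y - ((a - x)%R * B + (t - y)%R * D)))%C
    by (rewrite !RtoC_minus; ring).
  eapply Rle_trans; [apply Cmod_triangle |]; rewrite Cmod_opp; nra. }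
replace (circulation a b c d) with
  ((CInt (fun x => P x c - P x d) a b - (b - a)%R * ((c - d)%R * B))
   + (CInt (fun y => Q b y - Q a y) c d - (d - c)%R * ((b - a)%R * B)))%C
  by (unfold circulation; rewrite !RtoC_minus; ring).
eapply Rle_trans; [apply Cmod_triangle |].
apply (Rle_trans _ ((b - a) * (eps * L) + (d - c) * (eps * L))); [lra |].
unfold L; right; ring.
Qed.

(** The circulation is additive, so one of the four quarters carries at least a
    quarter of its modulus. *)
Lemma quarter_rectangle a b c d :
  a0 <= a -> a <= b -> b <= b0 -> c0 <= c -> c <= d -> d <= d0 ->
  exists a' c', a <= a' <= a + (b - a) / 2 /\ c <= c' <= c + (d - c) / 2 /\
    Cmod (circulation a b c d)
      <= 4 * Cmod (circulation a' (a' + (b - a) / 2) c' (c' + (d - c) / 2)).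
Proof.
intros ha hab hb hc hcd hd.
set (m := a + (b - a) / 2); set (n := c + (d - c) / 2).
assert (eqT : circulation a b c d =
  (circulation a m c n + circulation a m n d
   + (circulation m b c n + circulation m b n d))%C).
{ rewrite (circulation_split_x a m b c d); unfold m; try lra.
  rewrite <- !circulation_split_y; unfold n; try lra; reflexivity. }
assert (bound : Cmod (circulation a b c d) <=
  Cmod (circulation a m c n) + Cmod (circulation a m n d)
   + (Cmod (circulation m b c n) + Cmod (circulation m b n d))).
{ rewrite eqT.
  assert (t1 := Cmod_triangle
    (circulation a m c n + circulation a m n d)
    (circulation m b c n + circulation m b n d)).
  assert (t2 := Cmod_triangle (circulation a m c n) (circulation a m n d)).
  assert (t3 := Cmod_triangle (circulation m b c n) (circulation m b n d)).
  lra. }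
assert (hm : m + (b - a) / 2 = b) by (unfold m; lra).
assert (hn : n + (d - c) / 2 = d) by (unfold n; lra).
assert (hm' : a <= m) by (unfold m; lra).
assert (hn' : c <= n) by (unfold n; lra).
set (t := Cmod (circulation a b c d)) in *.
destruct (Rle_dec t (4 * Cmod (circulation a m c n))).
{ exists a, c; fold m n; repeat split; auto; lra. }
destruct (Rle_dec t (4 * Cmod (circulation a m n d))).
{ exists a, n; rewrite hn; fold m n; repeat split; auto; lra. }
destruct (Rle_dec t (4 * Cmod (circulation m b c n))).
{ exists m, c; rewrite hm; fold m n; repeat split; auto; lra. }
exists m, n; rewrite hm, hn; fold m n; repeat split; auto; lra.
Qed.

Hypotheses (ab0 : a0 <= b0) (cd0 : c0 <= d0).

(** Goursat's bisection argument. Repeated quartering leads to nested rectangles whose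
    circulations are at least t / 4^n, where t is the modulus of the whole; they shrink to
    a point, where differentiability bounds them by an arbitrarily small multiple of
    1 / 4^n. Hence t = 0. *)
Theorem Goursat : circulation a0 b0 c0 d0 = 0.
Proof.
set (la := b0 - a0); set (lc := d0 - c0).
set (T n (p : R * R) := circulation (fst p) (fst p + la / 2 ^ n)
                          (snd p) (snd p + lc / 2 ^ n)).
set (inside n (p : R * R) := a0 <= fst p /\ fst p + la / 2 ^ n <= b0 /\
                      c0 <= snd p /\ snd p + lc / 2 ^ n <= d0).
assert (half : forall l n, l / 2 ^ n / 2 = l / 2 ^ S n).
{ intros l n; assert (0 < 2 ^ n) by (apply pow_lt; lra); cbn; field; lra. }
assert (nonneg : forall l n, 0 <= l -> 0 <= l / 2 ^ n).
{ intros l n h; assert (0 < / 2 ^ n) by (apply Rinv_0_lt_compat, pow_lt; lra).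
  unfold Rdiv; nra. }
assert (step : forall n p, exists p', inside n p ->
   fst p <= fst p' <= fst p + la / 2 ^ S n /\
   snd p <= snd p' <= snd p + lc / 2 ^ S n /\
   Cmod (T n p) <= 4 * Cmod (T (S n) p')).
{ intros n p; destruct (classic (inside n p)) as [(h1 & h2 & h3 & h4) | h];
    [| exists p; tauto].
  assert (ha := nonneg la n); assert (hc := nonneg lc n).
  destruct (quarter_rectangle (fst p) (fst p + la / 2 ^ n)
              (snd p) (snd p + lc / 2 ^ n)) as (a' & c' & e1 & e2 & e3);
    try (unfold la, lc in *; lra).
  replace (fst p + la / 2 ^ n - fst p) with (la / 2 ^ n) in * by ring.
  replace (snd p + lc / 2 ^ n - snd p) with (lc / 2 ^ n) in * by ring.
  rewrite !half in *.
  exists (a', c'); intros _; auto. }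
set (next n p := proj1_sig (constructive_indefinite_description _ (step n p))).
assert (nextP : forall n p, inside n p ->
   fst p <= fst (next n p) <= fst p + la / 2 ^ S n /\
   snd p <= snd (next n p) <= snd p + lc / 2 ^ S n /\
   Cmod (T n p) <= 4 * Cmod (T (S n) (next n p))).
{ intros n p; exact (proj2_sig (constructive_indefinite_description _ (step n p))). }
set (r := fix r n := match n with O => (a0, c0) | S n => next n (r n) end).
assert (rin : forall n, inside n (r n)).
{ induction n as [| n IH].
  - unfold inside, la, lc; cbn; lra.
  - destruct (nextP n (r n) IH) as (h1 & h2 & _).
    change (r (S n)) with (next n (r n)).
    destruct IH as (i1 & i2 & i3 & i4).
    rewrite <- (half la), <- (half lc) in *.
    unfold inside; rewrite <- (half la), <- (half lc); lra. }
assert (rstep := fun n => nextP n (r n) (rin n)); cbn beta in rstep.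
assert (grow : forall n, Cmod (T 0%nat (r 0%nat)) <= 4 ^ n * Cmod (T n (r n))).
{ induction n as [| n IH]; [cbn [pow]; lra |].
  destruct (rstep n) as (_ & _ & h); change (next n (r n)) with (r (S n)) in h.
  assert (0 < 4 ^ n) by (apply pow_lt; lra); cbn [pow]; nra. }
assert (T0 : T 0%nat (r 0%nat) = circulation a0 b0 c0 d0).
{ unfold T; cbn; f_equal; unfold la, lc; field. }
destruct (nested_intervals_point (fun n => fst (r n)) la) as [x hx].
{ unfold la; lra. } { intros n; apply rstep. }
destruct (nested_intervals_point (fun n => snd (r n)) lc) as [y hy].
{ unfold lc; lra. } { intros n; apply rstep. }
assert (hx0 := hx 0%nat); assert (hy0 := hy 0%nat); cbn in hx0, hy0.
rewrite Rdiv_1_r in hx0, hy0; unfold la in hx0; unfold lc in hy0.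
rewrite <- T0 in *; apply Cmod_eq_0.
assert (pos := Cmod_ge_0 (T 0%nat (r 0%nat))).
destruct (Rle_lt_or_eq_dec _ _ pos) as [t0 | e]; [exfalso | symmetry; exact e].
(* The summand 1 keeps L positive when the rectangle is degenerate. *)
set (L := la + lc + 1); assert (Lpos : 0 < L) by (unfold L, la, lc; lra).
destruct (circulation_small x y ltac:(lra) ltac:(lra)
            (Cmod (T 0%nat (r 0%nat)) / (2 * L ^ 2)))
  as (delta & delta0 & hd).
{ apply Rdiv_lt_0_compat; nra. }
destruct (Pow_x_infinity 2 ltac:(rewrite Rabs_pos_eq; lra) (L / delta + 1))
  as [n hn].
specialize (hn n (le_n n)); rewrite Rabs_pos_eq in hn
  by (apply pow_le; lra).
assert (pn : 0 < 2 ^ n) by (apply pow_lt; lra).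
assert (Ld : L / 2 ^ n < delta).
{ apply (Rmult_lt_reg_r (2 ^ n)); auto.
  replace (L / 2 ^ n * 2 ^ n) with L by (field; lra).
  apply (Rle_lt_trans _ (delta * (L / delta))); [right; field; lra |].
  apply Rmult_lt_compat_l; lra. }
assert (lt_la : la / 2 ^ n <= L / 2 ^ n).
{ apply Rmult_le_compat_r; [left; apply Rinv_0_lt_compat; auto | unfold L, lc; lra]. }
assert (lt_lc : lc / 2 ^ n <= L / 2 ^ n).
{ apply Rmult_le_compat_r; [left; apply Rinv_0_lt_compat; auto | unfold L, la; lra]. }
destruct (rin n) as (i1 & i2 & i3 & i4); specialize (hx n); specialize (hy n).
cbn beta in hx, hy.
assert (fin := hd (fst (r n)) (fst (r n) + la / 2 ^ n)
   (snd (r n)) (snd (r n) + lc / 2 ^ n)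
   ltac:(lra) ltac:(lra) ltac:(lra) ltac:(lra) ltac:(lra) ltac:(lra)).
fold (T n (r n)) in fin; specialize (grow n).
set (t := Cmod (T 0%nat (r 0%nat))) in *.
replace (fst (r n) + la / 2 ^ n - fst (r n) + (snd (r n) + lc / 2 ^ n - snd (r n)))
  with ((la + lc) / 2 ^ n) in fin by (field; lra).
assert (e4 : 4 ^ n = 2 ^ n * 2 ^ n) by (rewrite <- Rpow_mult_distr; f_equal; lra).
assert (t <= t / 2 * ((la + lc) ^ 2 / L ^ 2)).
{ apply (Rle_trans _ _ _ grow); rewrite e4.
  apply (Rle_trans _ (2 ^ n * 2 ^ n * (t / (2 * L ^ 2) * ((la + lc) / 2 ^ n) ^ 2))).
  - apply Rmult_le_compat_l; nra.
  - right; field; lra. }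
assert ((la + lc) ^ 2 / L ^ 2 <= 1).
{ apply (Rmult_le_reg_r (L ^ 2)); [nra |].
  replace ((la + lc) ^ 2 / L ^ 2 * L ^ 2) with ((la + lc) ^ 2) by (field; lra).
  unfold L, la, lc in *; nra. }
nra.
Qed.

End Green.

(** * Holomorphic functions and the Cauchy integral formula *)

(** The target is C as a module over itself, so that scaling by the increment is complex
    multiplication. *)
Definition is_Cderive (h : C -> C) (z l : C) : Prop :=
  is_derive (K := C_AbsRing) (V := AbsRing_NormedModule C_AbsRing) h z l.

Lemma is_Cderive_eps (h : C -> C) (z l : C) :
  is_Cderive h z l <->
  (forall eps, 0 < eps -> exists delta, 0 < delta /\
     forall w, Cmod (w - z) < delta ->
       Cmod (h w - h z - (w - z) * l) <= eps * Cmod (w - z)).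
Proof.
split.
- intros [_ H] eps e0.
  destruct (H z (fun _ hP => hP) (mkposreal eps e0)) as [d hd].
  exists d; split; [apply cond_pos | intros w hw; exact (hd w hw)].
- intros H; split; [apply is_linear_scal_l |].
  intros x hx.
  rewrite <- (is_filter_lim_locally_unique (K := C_AbsRing)
                (V := AbsRing_NormedModule C_AbsRing) _ _ hx).
  intros eps; destruct (H eps (cond_pos eps)) as (d & d0 & hd).
  exists (mkposreal d d0); intros w hw; exact (hd w hw).
Qed.

Lemma is_Cderive_mult (g h : C -> C) (z k l : C) :
  is_Cderive g z k -> is_Cderive h z l ->
  is_Cderive (fun w => g w * h w)%C z (k * h z + g z * l)%C.
Proof.
intros hg hh.
exact (is_derive_mult (K := C_AbsRing) g h z k l hg hh Cmult_comm).
Qed.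

Lemma is_Cderive_inv (z : C) : z <> 0 -> is_Cderive Cinv z (- (/ (z * z)))%C.
Proof.
intros nz; apply is_Cderive_eps; intros eps e0.
assert (m0 : 0 < Cmod z) by (apply Cmod_gt_0; exact nz).
exists (Rmin (Cmod z / 2) (eps * Cmod z ^ 3 / 2)); split.
{ apply Rmin_pos; [lra |].
  assert (0 < Cmod z ^ 3) by (apply pow_lt; auto); nra. }
intros w hw.
assert (h1 := Rmin_l (Cmod z / 2) (eps * Cmod z ^ 3 / 2)).
assert (h2 := Rmin_r (Cmod z / 2) (eps * Cmod z ^ 3 / 2)).
assert (mw : Cmod z / 2 <= Cmod w).
{ assert (t := Cmod_triangle w (- (w - z))).
  rewrite Cmod_opp in t; replace (w + - (w - z))%C with z in t by ring; lra. }
assert (nw : w <> 0) by (apply Cmod_gt_0; lra).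
replace (/ w - / z - (w - z) * - / (z * z))%C with
  ((w - z) * ((w - z) * / (z * z * w)))%C by (field; split; auto).
rewrite 2!Cmod_mult, Cmod_inv, !Cmod_mult
  by (repeat apply Cmult_neq_0; auto).
rewrite Rmult_comm; apply Rmult_le_compat_r; [apply Cmod_ge_0 |].
assert (d0 : 0 < Cmod z * Cmod z * Cmod w) by (repeat apply Rmult_lt_0_compat; lra).
apply (Rmult_le_reg_r (Cmod z * Cmod z * Cmod w)); auto.
rewrite Rmult_assoc, Rinv_l, Rmult_1_r by lra.
apply (Rle_trans _ (eps * (Cmod z * Cmod z * (Cmod z / 2)))); [lra |].
apply Rmult_le_compat_l; [lra |]; apply Rmult_le_compat_l; [| exact mw].
apply Rmult_le_pos; lra.
Qed.

Lemma is_Cderive_const (c z : C) : is_Cderive (fun _ => c) z 0.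
Proof. exact (is_derive_const (K := C_AbsRing) (V := AbsRing_NormedModule C_AbsRing) c z). Qed.

Lemma is_Cderive_id (z : C) : is_Cderive (fun w => w) z 1.
Proof. exact (is_derive_id (K := C_AbsRing) z). Qed.

Lemma is_Cderive_comp (g h : C -> C) (z k l : C) :
  is_Cderive g (h z) k -> is_Cderive h z l ->
  is_Cderive (fun w => g (h w)) z (l * k)%C.
Proof. intros hg hh; exact (is_derive_comp (K := C_AbsRing) (V := AbsRing_NormedModule C_AbsRing) g h z k l hg hh). Qed.

Lemma is_Cderive_plus (g h : C -> C) (z k l : C) :
  is_Cderive g z k -> is_Cderive h z l ->
  is_Cderive (fun w => g w + h w)%C z (k + l)%C.
Proof. intros hg hh; exact (is_derive_plus (K := C_AbsRing) (V := AbsRing_NormedModule C_AbsRing) g h z k l hg hh). Qed.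

Lemma is_Cderive_minus (g h : C -> C) (z k l : C) :
  is_Cderive g z k -> is_Cderive h z l ->
  is_Cderive (fun w => g w - h w)%C z (k - l)%C.
Proof. intros hg hh; exact (is_derive_minus (K := C_AbsRing) (V := AbsRing_NormedModule C_AbsRing) g h z k l hg hh). Qed.

Lemma total_diff_eq P x y A B A' B' :
  total_diff P x y A B -> A = A' -> B = B' -> total_diff P x y A' B'.
Proof. intros h <- <-; exact h. Qed.

Lemma total_diff_const (c : C) x y : total_diff (fun _ _ => c) x y 0 0.
Proof.
intros eps e0; exists 1; split; [lra |]; intros x' y' _ _.
replace (c - c - ((x' - x)%R * 0 + (y' - y)%R * 0))%C with (RtoC 0) by ring.
rewrite Cmod_0; pose proof (Rabs_pos (x' - x)); pose proof (Rabs_pos (y' - y)); nra.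
Qed.

Lemma total_diff_fst x y : total_diff (fun s _ => RtoC s) x y 1 0.
Proof.
intros eps e0; exists 1; split; [lra |]; intros x' y' _ _.
replace (x' - x - ((x' - x)%R * 1 + (y' - y)%R * 0))%C with (RtoC 0)
  by (rewrite RtoC_minus; ring).
rewrite Cmod_0; pose proof (Rabs_pos (x' - x)); pose proof (Rabs_pos (y' - y)); nra.
Qed.

Lemma total_diff_minus P Q x y A B A' B' :
  total_diff P x y A B -> total_diff Q x y A' B' ->
  total_diff (fun s t => P s t - Q s t)%C x y (A - A')%C (B - B')%C.
Proof.
intros hP hQ eps e0.
destruct (hP (eps / 2) ltac:(lra)) as (d1 & d1pos & hd1).
destruct (hQ (eps / 2) ltac:(lra)) as (d2 & d2pos & hd2).
exists (Rmin d1 d2); split; [apply Rmin_pos; auto |]; intros x' y' hx hy.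
assert (m1 := Rmin_l d1 d2); assert (m2 := Rmin_r d1 d2).
assert (e1 := hd1 x' y' ltac:(lra) ltac:(lra)).
assert (e2 := hd2 x' y' ltac:(lra) ltac:(lra)).
match goal with |- Cmod ?e <= _ => replace e with
  ((P x' y' - P x y - ((x' - x)%R * A + (y' - y)%R * B))
   + - (Q x' y' - Q x y - ((x' - x)%R * A' + (y' - y)%R * B')))%C by ring end.
eapply Rle_trans; [apply Cmod_triangle |]; rewrite Cmod_opp; nra.
Qed.

Lemma total_diff_mult P Q x y A B A' B' :
  total_diff P x y A B -> total_diff Q x y A' B' ->
  total_diff (fun s t => P s t * Q s t)%C x y
    (A * Q x y + P x y * A')%C (B * Q x y + P x y * B')%C.
Proof.
intros hP hQ eps e0.
destruct (total_diff_lipschitz _ _ _ _ _ hP) as (k1 & d1 & k1pos & d1pos & l1).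
destruct (total_diff_lipschitz _ _ _ _ _ hQ) as (k2 & d2 & k2pos & d2pos & l2).
set (p := Cmod (P x y)); set (q := Cmod (Q x y)).
assert (p0 : 0 <= p) by apply Cmod_ge_0; assert (q0 : 0 <= q) by apply Cmod_ge_0.
assert (pq : 0 < 1 + p + q) by lra.
set (eps' := eps / (2 * (1 + p + q))).
assert (eps'0 : 0 < eps') by (apply Rdiv_lt_0_compat; lra).
destruct (hP eps' eps'0) as (d3 & d3pos & l3).
destruct (hQ eps' eps'0) as (d4 & d4pos & l4).
set (d5 := eps / (4 * (k1 * k2))).
assert (d5pos : 0 < d5) by (apply Rdiv_lt_0_compat; nra).
exists (Rmin (Rmin d1 d2) (Rmin (Rmin d3 d4) d5)); split.
{ repeat apply Rmin_pos; auto. }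
intros x' y' hx hy.
assert (small : forall d, List.In d (cons d1 (cons d2 (cons d3 (cons d4 (cons d5 nil))))) ->
   Rmin (Rmin d1 d2) (Rmin (Rmin d3 d4) d5) <= d).
{ intros d hd; cbn in hd; unfold Rmin;
  repeat destruct Rle_dec; intuition (subst; lra). }
assert (s1 := small d1 ltac:(cbn; tauto)); assert (s2 := small d2 ltac:(cbn; tauto)).
assert (s3 := small d3 ltac:(cbn; tauto)); assert (s4 := small d4 ltac:(cbn; tauto)).
assert (s5 := small d5 ltac:(cbn; tauto)); clear small.
specialize (l1 x' y' ltac:(lra) ltac:(lra)); specialize (l2 x' y' ltac:(lra) ltac:(lra)).
specialize (l3 x' y' ltac:(lra) ltac:(lra)); specialize (l4 x' y' ltac:(lra) ltac:(lra)).
set (L := Rabs (x' - x) + Rabs (y' - y)) in *.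
assert (L0 : 0 <= L) by (unfold L; pose proof (Rabs_pos (x' - x));
  pose proof (Rabs_pos (y' - y)); lra).
assert (L5 : L <= 2 * d5) by (unfold L; lra).
match goal with |- Cmod ?e <= _ => replace e with
  ((P x' y' - P x y) * (Q x' y' - Q x y)
   + ((P x' y' - P x y - ((x' - x)%R * A + (y' - y)%R * B)) * Q x y
   + P x y * (Q x' y' - Q x y - ((x' - x)%R * A' + (y' - y)%R * B'))))%C by ring end.
eapply Rle_trans; [apply Cmod_triangle |].
eapply Rle_trans; [apply Rplus_le_compat_l, Cmod_triangle |].
rewrite !Cmod_mult; fold p q.
assert (b1 : Cmod (P x' y' - P x y) * Cmod (Q x' y' - Q x y)
               <= (k1 * L) * (k2 * L)).
{ apply Rmult_le_compat; auto using Cmod_ge_0. }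
assert (b2 : (k1 * L) * (k2 * L) <= eps / 2 * L).
{ replace ((k1 * L) * (k2 * L)) with (k1 * k2 * L * L) by ring.
  apply Rmult_le_compat_r; auto.
  apply (Rle_trans _ (k1 * k2 * (2 * d5))).
  - apply Rmult_le_compat_l; nra.
  - unfold d5; right; field; lra. }
assert (b3 : eps' * L * q + p * (eps' * L) <= eps / 2 * L).
{ replace (eps' * L * q + p * (eps' * L)) with (eps' * (p + q) * L) by ring.
  apply Rmult_le_compat_r; auto.
  apply (Rle_trans _ (eps' * (1 + p + q))); [nra |].
  unfold eps'; right; field; lra. }
nra.
Qed.

Lemma total_diff_comp (h : C -> C) P x y l A B :
  is_Cderive h (P x y) l -> total_diff P x y A B ->
  total_diff (fun s t => h (P s t)) x y (l * A)%C (l * B)%C.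
Proof.
intros hh hP eps e0.
destruct (total_diff_lipschitz _ _ _ _ _ hP) as (k & d1 & k0 & d1pos & l1).
destruct (proj1 (is_Cderive_eps _ _ _) hh (eps / (2 * k))) as (d2 & d2pos & l2).
{ apply Rdiv_lt_0_compat; lra. }
assert (m0 := Cmod_ge_0 l).
destruct (hP (eps / (2 * (1 + Cmod l)))) as (d3 & d3pos & l3).
{ apply Rdiv_lt_0_compat; lra. }
assert (d4pos : 0 < d2 / (2 * k)) by (apply Rdiv_lt_0_compat; lra).
exists (Rmin d1 (Rmin (d2 / (2 * k)) d3)); split.
{ repeat apply Rmin_pos; auto. }
intros x' y' hx hy.
assert (m1 := Rmin_l d1 (Rmin (d2 / (2 * k)) d3)).
assert (m2 := Rmin_r d1 (Rmin (d2 / (2 * k)) d3)).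
assert (m3 := Rmin_l (d2 / (2 * k)) d3); assert (m4 := Rmin_r (d2 / (2 * k)) d3).
specialize (l1 x' y' ltac:(lra) ltac:(lra)); specialize (l3 x' y' ltac:(lra) ltac:(lra)).
set (L := Rabs (x' - x) + Rabs (y' - y)) in *.
assert (L4 : L < 2 * (d2 / (2 * k))) by (unfold L; lra).
assert (L0 : 0 <= L) by (unfold L; pose proof (Rabs_pos (x' - x));
  pose proof (Rabs_pos (y' - y)); lra).
assert (kL : k * L < d2).
{ apply (Rlt_le_trans _ (k * (2 * (d2 / (2 * k))))).
  - apply Rmult_lt_compat_l; auto.
  - right; field; lra. }
specialize (l2 (P x' y') ltac:(lra)).
match goal with |- Cmod ?e <= _ => replace e with
  ((h (P x' y') - h (P x y) - (P x' y' - P x y) * l)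
   + (P x' y' - P x y - ((x' - x)%R * A + (y' - y)%R * B)) * l)%C by ring end.
eapply Rle_trans; [apply Cmod_triangle |]; rewrite Cmod_mult.
assert (b1 : eps / (2 * k) * Cmod (P x' y' - P x y) <= eps / 2 * L).
{ apply (Rle_trans _ (eps / (2 * k) * (k * L))).
  - apply Rmult_le_compat_l; auto; left; apply Rdiv_lt_0_compat; lra.
  - right; field; lra. }
assert (b2 : Cmod (P x' y' - P x y - ((x' - x)%R * A + (y' - y)%R * B)) * Cmod l
   <= eps / 2 * L).
{ apply (Rle_trans _ (eps / (2 * (1 + Cmod l)) * L * (1 + Cmod l))).
  - apply Rmult_le_compat; auto using Cmod_ge_0; lra.
  - right; field; lra. }
nra.
Qed.

Lemma is_Cderive_conj h z l : is_Cderive h (Cconj z) l ->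
  is_Cderive (fun w => Cconj (h (Cconj w))) z (Cconj l).
Proof.
intros hl; apply is_Cderive_eps; intros eps e0.
destruct (proj1 (is_Cderive_eps _ _ _) hl eps e0) as (d & d0 & hd).
assert (e : forall w, (Cconj w - Cconj z)%C = Cconj (w - z)%C).
{ intros w; apply injective_projections; cbn; ring. }
exists d; split; auto; intros w hw; specialize (hd (Cconj w)).
rewrite e, Cmod_conj in hd; specialize (hd hw).
rewrite <- Cmod_conj; eapply Rle_trans; [right | exact hd]; f_equal.
apply injective_projections; cbn; ring.
Qed.

Definition cis (t : R) : C := (cos t, sin t).

Lemma Cmod_cis t : Cmod (cis t) = 1.
Proof.
unfold Cmod, cis; cbn [fst snd]; rewrite <- sqrt_1; f_equal.
assert (h := sin2_cos2 t); unfold Rsqr in h; lra.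
Qed.

Lemma cis_nz t : cis t <> 0.
Proof. apply Cmod_gt_0; rewrite Cmod_cis; lra. Qed.

Lemma total_diff_cis x y : total_diff (fun _ t => cis t) x y 0 (Ci * cis y)%C.
Proof.
intros eps e0.
destruct (derivable_pt_lim_cos y (eps / 2) ltac:(lra)) as [d1 hd1].
destruct (derivable_pt_lim_sin y (eps / 2) ltac:(lra)) as [d2 hd2].
exists (Rmin d1 d2); split; [apply Rmin_pos; apply cond_pos |].
intros x' y' _ hy.
assert (m1 := Rmin_l d1 d2); assert (m2 := Rmin_r d1 d2).
assert (key : forall (f : R -> R) (l : R) (d : posreal),
  (forall h, h <> 0 -> Rabs h < d -> Rabs ((f (y + h) - f y) / h - l) < eps / 2) ->
  Rmin d1 d2 <= d ->
  Rabs (f y' - f y - (y' - y) * l) <= eps / 2 * Rabs (y' - y)).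
{ intros f l d hd md; destruct (Req_dec y' y) as [-> | ne].
  - rewrite !Rminus_eq_0, Rmult_0_l, Rminus_0_r, Rabs_R0; lra.
  - specialize (hd (y' - y) ltac:(lra) ltac:(lra)).
    replace (y + (y' - y)) with y' in hd by ring.
    replace (f y' - f y - (y' - y) * l) with
      (((f y' - f y) / (y' - y) - l) * (y' - y)) by (field; lra).
    rewrite Rabs_mult; apply Rmult_le_compat_r; [apply Rabs_pos | lra]. }
assert (k1 := key cos (- sin y) d1 hd1 m1); assert (k2 := key sin (cos y) d2 hd2 m2).
match goal with |- Cmod ?e <= _ => replace e with
  (RtoC (cos y' - cos y - (y' - y) * - sin y)
   + Ci * RtoC (sin y' - sin y - (y' - y) * cos y))%C end.
- eapply Rle_trans; [apply Cmod_triangle |].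
  rewrite Cmod_mult, Cmod_Ci, !Cmod_R; pose proof (Rabs_pos (x' - x)); nra.
- apply injective_projections; cbn; ring.
Qed.

Definition ex_total_diff (P : R -> R -> C) (x y : R) : Prop :=
  exists A B, total_diff P x y A B.

Lemma ex_total_diff_mult P Q x y : ex_total_diff P x y -> ex_total_diff Q x y ->
  ex_total_diff (fun s t => P s t * Q s t)%C x y.
Proof.
intros (A & B & hP) (A' & B' & hQ); eexists; eexists.
exact (total_diff_mult _ _ _ _ _ _ _ _ hP hQ).
Qed.

Lemma ex_total_diff_minus P Q x y : ex_total_diff P x y -> ex_total_diff Q x y ->
  ex_total_diff (fun s t => P s t - Q s t)%C x y.
Proof.
intros (A & B & hP) (A' & B' & hQ); eexists; eexists.
exact (total_diff_minus _ _ _ _ _ _ _ _ hP hQ).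
Qed.

Lemma ex_total_diff_const c x y : ex_total_diff (fun _ _ => c) x y.
Proof. eexists; eexists; apply total_diff_const. Qed.

Lemma ex_total_diff_pow P x y n : ex_total_diff P x y ->
  ex_total_diff (fun s t => P s t ^ n)%C x y.
Proof.
intros hP; induction n as [| n IH]; [exact (ex_total_diff_const 1 x y) |].
exact (ex_total_diff_mult _ _ _ _ hP IH).
Qed.

Lemma is_Cderive_continuous (h : C -> C) (z l : C) : is_Cderive h z l ->
  forall eps, 0 < eps -> exists delta, 0 < delta /\
    forall w, Cmod (w - z) < delta -> Cmod (h w - h z) < eps.
Proof.
intros hl eps e0.
destruct (proj1 (is_Cderive_eps _ _ _) hl 1 Rlt_0_1) as (d & d0 & hd).
assert (m0 := Cmod_ge_0 l).
exists (Rmin d (eps / (2 + Cmod l))); split.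
{ apply Rmin_pos; auto; apply Rdiv_lt_0_compat; lra. }
intros w hw.
assert (m1 := Rmin_l d (eps / (2 + Cmod l))).
assert (m2 := Rmin_r d (eps / (2 + Cmod l))).
specialize (hd w ltac:(lra)).
replace (h w - h z)%C with ((h w - h z - (w - z) * l) + (w - z) * l)%C by ring.
eapply Rle_lt_trans; [apply Cmod_triangle |]; rewrite Cmod_mult.
assert (w0 := Cmod_ge_0 (w - z)).
apply (Rle_lt_trans _ (Cmod (w - z) * (1 + Cmod l))); [nra |].
apply (Rle_lt_trans _ (eps / (2 + Cmod l) * (1 + Cmod l))).
- apply Rmult_le_compat_r; lra.
- apply (Rlt_le_trans _ (eps / (2 + Cmod l) * (2 + Cmod l))).
  + apply Rmult_lt_compat_l; [apply Rdiv_lt_0_compat |]; lra.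
  + right; field; lra.
Qed.

Lemma CInt_Cmult (c : C) (f : R -> C) (a b : R) :
  a <= b -> (forall t, a <= t <= b -> Ccont f t) ->
  CInt (fun t => c * f t)%C a b = (c * CInt f a b)%C.
Proof.
intros ab hf.
assert (I := RInt_correct (V := C_R_CompleteNormedModule) f a b (ex_CInt f a b ab hf)).
fold (CInt f a b) in I.
assert (I1 := is_RInt_fct_extend_fst _ _ _ _ I).
assert (I2 := is_RInt_fct_extend_snd _ _ _ _ I).
apply (is_RInt_unique (V := C_R_CompleteNormedModule)).
apply (is_RInt_fct_extend_pair (U := R_NormedModule) (V := R_NormedModule)).
- exact (is_RInt_minus (V := R_NormedModule) _ _ _ _ _ _
    (is_RInt_scal _ _ _ (fst c) _ I1) (is_RInt_scal _ _ _ (snd c) _ I2)).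
- exact (is_RInt_plus (V := R_NormedModule) _ _ _ _ _ _
    (is_RInt_scal _ _ _ (fst c) _ I2) (is_RInt_scal _ _ _ (snd c) _ I1)).
Qed.

Lemma CInt_plus (f g : R -> C) (a b : R) :
  a <= b -> (forall t, a <= t <= b -> Ccont f t) ->
  (forall t, a <= t <= b -> Ccont g t) ->
  CInt (fun t => f t + g t)%C a b = (CInt f a b + CInt g a b)%C.
Proof.
intros ab hf hg.
apply (RInt_plus (V := C_R_CompleteNormedModule)); apply ex_CInt; auto.
Qed.

Lemma Ccont_snd P x y : ex_total_diff P x y -> Ccont (fun t => P x t) y.
Proof. intros (A & B & h); exact (total_diff_Ccont_snd _ _ _ _ _ h). Qed.

Lemma cis_pow (t : R) (n : nat) : (cis t ^ n)%C = cis (INR n * t).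
Proof.
induction n as [| n IH].
- cbn [INR Cpow]; unfold cis; rewrite Rmult_0_l, cos_0, sin_0; reflexivity.
- rewrite Cpow_S, IH, S_INR; unfold cis, Cmult; cbn [fst snd].
  replace ((INR n + 1) * t) with (t + INR n * t) by ring.
  rewrite cos_plus, sin_plus; f_equal; ring.
Qed.

Lemma cis_period (t : R) : cis (t + 2 * PI) = cis t.
Proof.
unfold cis; rewrite cos_plus, sin_plus, cos_2PI, sin_2PI; f_equal; ring.
Qed.

(** Orthogonality of the characters of the circle: it isolates one Taylor coefficient. *)
Lemma CInt_inv_cis_pow (n : nat) : (0 < n)%nat ->
  CInt (fun t => (/ cis t) ^ n)%C 0 (2 * PI) = 0.
Proof.
intros hn; assert (n0 : INR n <> 0) by (apply not_0_INR; lia).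
assert (inv : forall t, (/ cis t)%C = (cos t, - sin t)).
{ intros t; assert (h := sin2_cos2 t); unfold Rsqr in h.
  unfold cis, Cinv; cbn [fst snd].
  replace (cos t ^ 2 + sin t ^ 2) with 1 by lra; f_equal; field. }
assert (eqf : forall t, ((/ cis t) ^ n)%C = (cos (INR n * t), - sin (INR n * t))).
{ intros t; rewrite Cpow_inv by apply cis_nz; rewrite cis_pow; apply inv. }
assert (c1 : cos (INR n * (2 * PI)) = 1).
{ rewrite <- cos_0, <- (cos_period 0 n); f_equal; ring. }
assert (s1 : sin (INR n * (2 * PI)) = 0).
{ rewrite <- sin_0, <- (sin_period 0 n); f_equal; ring. }
assert (hpi := PI_RGT_0).
rewrite (CInt_ext _ (fun t => (cos (INR n * t), - sin (INR n * t))))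
  by (try lra; intros; apply eqf).
apply (is_RInt_unique (V := C_R_CompleteNormedModule)).
apply (is_RInt_fct_extend_pair (U := R_NormedModule) (V := R_NormedModule)); cbn.
- assert (k : is_RInt (fun t => cos (INR n * t)) 0 (2 * PI)
    (minus (sin (INR n * (2 * PI)) / INR n) (sin (INR n * 0) / INR n))).
  { apply (is_RInt_derive (fun t => sin (INR n * t) / INR n)); intros t _.
    - auto_derive; auto; field; auto.
    - apply continuity_pt_filterlim; reg. }
  rewrite s1, Rmult_0_r, sin_0, minus_eq_zero in k; exact k.
- assert (k : is_RInt (fun t => - sin (INR n * t)) 0 (2 * PI)
    (minus (cos (INR n * (2 * PI)) / INR n) (cos (INR n * 0) / INR n))).
  { apply (is_RInt_derive (fun t => cos (INR n * t) / INR n)); intros t _.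
    - auto_derive; auto; field; auto.
    - apply continuity_pt_filterlim; reg. }
  rewrite c1, Rmult_0_r, cos_0, minus_eq_zero in k; exact k.
Qed.

Section Cauchy.

Variables (h : C -> C) (r rho : R).
Hypothesis holo : forall z, Cmod z < r -> exists l, is_Cderive h z l.
Hypothesis rho_pos : 0 < rho.
Hypothesis rho_lt : rho < r.

Definition circle_pt (t : R) : C := (rho * cis t)%C.

Lemma Cmod_circle_pt t : Cmod (circle_pt t) = rho.
Proof.
unfold circle_pt; rewrite Cmod_mult, Cmod_cis, Cmod_R, Rabs_pos_eq; lra.
Qed.

Lemma circle_pt_nz t : circle_pt t <> 0.
Proof. apply Cmod_gt_0; rewrite Cmod_circle_pt; auto. Qed.

Lemma total_diff_circle_pt x y : total_diff (fun _ t => circle_pt t) x y 0 (Ci * circle_pt y)%C.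
Proof.
refine (total_diff_eq _ _ _ _ _ _ _ (total_diff_mult _ _ _ _ _ _ _ _
  (total_diff_const rho x y) (total_diff_cis x y)) _ _); unfold circle_pt; ring.
Qed.

Section Point.

Variable a : C.
Hypothesis ha : Cmod a < rho.

Lemma circle_pt_minus_nz t : (circle_pt t - a)%C <> 0.
Proof.
intros e; assert (circle_pt t = a) as e2.
{ replace (circle_pt t) with (circle_pt t - a + a)%C by ring; rewrite e; ring. }
assert (k := Cmod_circle_pt t); rewrite e2 in k; lra.
Qed.

(** The Cauchy kernel z / (z - a) on the circle: dz / (z - a) = i (kernel t) dt. *)
Definition kernel (t : R) : C := (circle_pt t * / (circle_pt t - a))%C.

Lemma total_diff_kernel x y : exists B, total_diff (fun _ t => kernel t) x y 0 B.
Proof.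
eexists; refine (total_diff_eq _ _ _ _ _ _ _
  (total_diff_mult _ _ _ _ _ _ _ _ (total_diff_circle_pt x y)
     (total_diff_comp Cinv (fun _ t => circle_pt t - a)%C x y _ _ _
        (is_Cderive_inv _ (circle_pt_minus_nz y))
        (total_diff_minus _ _ _ _ _ _ _ _ (total_diff_circle_pt x y)
           (total_diff_const a x y)))) _ eq_refl); ring.
Qed.

Lemma Cmod_kernel t : Cmod (kernel t) <= rho / (rho - Cmod a).
Proof.
unfold kernel; rewrite Cmod_mult, Cmod_inv, Cmod_circle_pt by apply circle_pt_minus_nz.
apply Rmult_le_compat_l; [lra |]; apply Rinv_le_contravar; [lra |].
assert (k := Cmod_triangle (circle_pt t - a) a).
replace (circle_pt t - a + a)%C with (circle_pt t) in k by ring.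
rewrite Cmod_circle_pt in k; lra.
Qed.

(** The homothety of ratio s and centre a, applied to the circle. As s goes from 1 to 0
    it contracts the circle to the point a inside the disc. *)
Definition shrink (s t : R) : C := (a - s * (a - circle_pt t))%C.

Lemma Cmod_shrink s t : 0 <= s <= 1 -> Cmod (shrink s t) <= rho.
Proof.
intros hs; unfold shrink.
replace (a - s * (a - circle_pt t))%C with ((1 - s)%R * a + s * circle_pt t)%C
  by (rewrite RtoC_minus; ring).
eapply Rle_trans; [apply Cmod_triangle |].
rewrite !Cmod_mult, !Cmod_R, Cmod_circle_pt, !Rabs_pos_eq by lra; nra.
Qed.

Lemma total_diff_shrink s t :
  total_diff shrink s t (circle_pt t - a)%C (s * (Ci * circle_pt t))%C.
Proof.
refine (total_diff_eq _ _ _ _ _ _ _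
  (total_diff_minus _ _ _ _ _ _ _ _ (total_diff_const a s t)
     (total_diff_mult _ _ _ _ _ _ _ _ (total_diff_fst s t)
        (total_diff_minus _ _ _ _ _ _ _ _ (total_diff_const a s t)
           (total_diff_circle_pt s t)))) _ _); cbn beta; ring.
Qed.

(** The two components of - i h(z) dz / (z - a) pulled back by the homothety. *)
Definition shrink_form_ds (s t : R) : C := (- Ci * h (shrink s t) * / (RtoC s))%C.
Definition shrink_form_dt (s t : R) : C := (h (shrink s t) * kernel t)%C.

(** Both cross derivatives are h' (shrink s t) times circle_pt t, whence the pulled back
    form is closed at each point where h has a derivative. *)
Lemma closed_shrink_form s t : 0 < s <= 1 ->
  exists A B D, total_diff shrink_form_ds s t A B /\ total_diff shrink_form_dt s t B D.
Proof.
intros hs.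
assert (in_disc : Cmod (shrink s t) < r).
{ apply (Rle_lt_trans _ rho); auto; apply Cmod_shrink; lra. }
destruct (holo _ in_disc) as [l hl].
assert (hcomp := total_diff_comp h shrink s t l _ _ hl (total_diff_shrink s t)).
destruct (total_diff_kernel s t) as (D & hk).
assert (s0 : RtoC s <> 0) by (intros e; apply RtoC_inj in e; lra).
assert (hP := total_diff_mult _ _ _ _ _ _ _ _
  (total_diff_mult _ _ _ _ _ _ _ _ (total_diff_const (- Ci) s t) hcomp)
  (total_diff_comp Cinv _ s t _ _ _ (is_Cderive_inv _ s0) (total_diff_fst s t))).
assert (hQ := total_diff_mult _ _ _ _ _ _ _ _ hcomp hk).
eexists; eexists; eexists; split; [exact hP |].
apply (total_diff_eq _ _ _ _ _ _ _ hQ); [| reflexivity].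
assert (nz := circle_pt_minus_nz t).
assert (i2 : (Ci * Ci = -1)%C) by (unfold Ci, Cmult, RtoC; cbn; f_equal; ring).
unfold kernel; cbn beta.
transitivity (l * circle_pt t)%C; [field; auto |].
transitivity (- (Ci * Ci) * l * circle_pt t)%C; [rewrite i2; ring | field; auto].
Qed.

Lemma ex_total_diff_h_shrink s t : 0 <= s <= 1 ->
  ex_total_diff (fun s t => h (shrink s t)) s t.
Proof.
intros hs; destruct (holo (shrink s t)) as [l hl].
{ apply (Rle_lt_trans _ rho); auto; apply Cmod_shrink; auto. }
eexists; eexists; exact (total_diff_comp _ _ _ _ _ _ _ hl (total_diff_shrink s t)).
Qed.

Lemma shrink_1 t : shrink 1 t = circle_pt t.
Proof. unfold shrink; ring. Qed.

Lemma Ccont_form s c t : 0 <= s <= 1 -> Ccont (fun t => (h (shrink s t) - c) * kernel t)%C t.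
Proof.
intros hs.
apply (Ccont_snd (fun s t => (h (shrink s t) - c) * kernel t)%C s).
apply ex_total_diff_mult.
- apply ex_total_diff_minus; [apply ex_total_diff_h_shrink; auto |].
  apply ex_total_diff_const.
- destruct (total_diff_kernel s t) as [D hD]; exists (RtoC 0), D; exact hD.
Qed.

(** Cauchy's integral formula, with h a moved inside the integral. Along the homotopy the
    closed form has the same integral on all the contracted circles, since the sides t = 0
    and t = 2 PI of the rectangle cancel by periodicity; and on small circles h is close
    to h a. *)
Lemma Cauchy_difference :
  CInt (fun t => (h (circle_pt t) - h a) * kernel t)%C 0 (2 * PI) = 0.
Proof.
assert (hpi := PI_RGT_0).
assert (shift : forall s, 0 < s < 1 ->
  CInt (fun t => (h (circle_pt t) - h a) * kernel t)%C 0 (2 * PI)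
  = CInt (fun t => (h (shrink s t) - h a) * kernel t)%C 0 (2 * PI)).
{ intros s hs.
  assert (G := Goursat shrink_form_ds shrink_form_dt s 1 0 (2 * PI)
    (fun x y hx _ => closed_shrink_form x y ltac:(lra)) ltac:(lra) ltac:(lra)).
  unfold circulation in G.
  rewrite (CInt_ext (fun x => shrink_form_ds x 0 - shrink_form_ds x (2 * PI))%C (fun _ => 0)) in G
    by (try lra; intros x _; unfold shrink_form_ds, shrink, circle_pt;
        rewrite <- (cis_period 0), Rplus_0_l; ring).
  rewrite CInt_const, Cmult_0_r, Cplus_0_l in G.
  rewrite (CInt_ext (fun t => shrink_form_dt 1 t - shrink_form_dt s t)%C
    (fun t => (h (shrink 1 t) - h a) * kernel t - (h (shrink s t) - h a) * kernel t)%C) in G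
    by (try lra; intros t _; unfold shrink_form_dt; ring).
  rewrite CInt_minus in G by (try lra; intros t _; apply Ccont_form; lra).
  rewrite (CInt_ext (fun t => (h (circle_pt t) - h a) * kernel t)%C
    (fun t => (h (shrink 1 t) - h a) * kernel t)%C)
    by (try lra; intros t _; rewrite shrink_1; ring).
  match type of G with (?u - ?v)%C = _ =>
    replace u with ((u - v) + v)%C by ring; rewrite G; ring end. }
apply Cmod_eq_0; apply Rle_antisym; [| apply Cmod_ge_0].
apply le_epsilon; intros eps e0; rewrite Rplus_0_l.
assert (m0 := Cmod_ge_0 a).
set (k := rho / (rho - Cmod a)).
assert (k0 : 0 < k) by (apply Rdiv_lt_0_compat; lra).
destruct (holo a ltac:(lra)) as [l hl].
destruct (is_Cderive_continuous h a l hl (eps / (2 * PI * k))) as (d & d0 & hd).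
{ apply Rdiv_lt_0_compat; auto; apply Rmult_lt_0_compat; lra. }
set (s := Rmin (1 / 2) (d / (4 * rho))).
assert (s0 : 0 < s) by (apply Rmin_pos; [lra | apply Rdiv_lt_0_compat; lra]).
assert (s1 := Rmin_l (1 / 2) (d / (4 * rho))); fold s in s1.
assert (s2 := Rmin_r (1 / 2) (d / (4 * rho))); fold s in s2.
rewrite (shift s) by lra.
replace eps with ((2 * PI - 0) * (eps / (2 * PI * k) * k)) by (field; lra).
apply CInt_bound; [lra | intros t _; apply Ccont_form; lra |]; intros t _.
rewrite Cmod_mult; apply Rmult_le_compat; auto using Cmod_ge_0, Cmod_kernel.
left; apply hd; unfold shrink.
replace (a - s * (a - circle_pt t) - a)%C with (s * (circle_pt t - a))%C by ring.
rewrite Cmod_mult, Cmod_R, Rabs_pos_eq by lra.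
assert (tri := Cmod_triangle (circle_pt t) (- a)).
rewrite Cmod_opp, Cmod_circle_pt in tri.
apply (Rle_lt_trans _ (s * (2 * rho))).
- apply Rmult_le_compat_l; unfold Cminus; lra.
- apply (Rle_lt_trans _ (d / (4 * rho) * (2 * rho))).
  + apply Rmult_le_compat_r; lra.
  + replace (d / (4 * rho) * (2 * rho)) with (d / 2) by (field; lra); lra.
Qed.

End Point.

Definition coef (n : nat) : C :=
  (/ (2 * PI)%R * CInt (fun t => h (circle_pt t) * (/ circle_pt t) ^ n)%C 0 (2 * PI))%C.

Fixpoint taylor (a : C) (n : nat) : C :=
  match n with O => 0 | S n => taylor a n + coef n * a ^ n end%C.

Lemma Ccont_on_circle t : Ccont (fun t => h (circle_pt t)) t.
Proof.
apply (Ccont_snd (fun _ t => h (circle_pt t)) 0).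
destruct (holo (circle_pt t)) as [l hl]; [rewrite Cmod_circle_pt; auto |].
eexists; eexists; exact (total_diff_comp _ _ _ _ _ _ _ hl (total_diff_circle_pt 0 t)).
Qed.

Lemma ex_total_diff_on_circle x t : ex_total_diff (fun _ t => h (circle_pt t)) x t.
Proof.
destruct (holo (circle_pt t)) as [l hl]; [rewrite Cmod_circle_pt; auto |].
eexists; eexists; exact (total_diff_comp _ _ _ _ _ _ _ hl (total_diff_circle_pt x t)).
Qed.

Lemma ex_total_diff_inv_circle_pt x t : ex_total_diff (fun _ t => / circle_pt t)%C x t.
Proof.
eexists; eexists; exact (total_diff_comp Cinv _ _ _ _ _ _
  (is_Cderive_inv _ (circle_pt_nz t)) (total_diff_circle_pt x t)).
Qed.

Ltac circle_continuity :=
  match goal with |- Ccont ?g ?t => apply (Ccont_snd (fun _ => g) 0 t) end;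
  repeat first
    [ apply ex_total_diff_const | apply ex_total_diff_on_circle
    | apply ex_total_diff_inv_circle_pt | apply ex_total_diff_pow
    | apply ex_total_diff_minus | apply ex_total_diff_mult ].

Lemma Ccont_remainder a n t : Cmod a < rho ->
  Ccont (fun t => (h (circle_pt t) - h a) * kernel a t * (a * / circle_pt t) ^ n)%C t.
Proof.
intros ha.
apply (Ccont_snd (fun _ t => (h (circle_pt t) - h a) * kernel a t * (a * / circle_pt t) ^ n)%C 0).
apply ex_total_diff_mult; [apply ex_total_diff_mult |].
- apply ex_total_diff_minus; [apply ex_total_diff_on_circle | apply ex_total_diff_const].
- destruct (total_diff_kernel a ha 0 t) as [D hD]; eexists; eexists; exact hD.
- apply ex_total_diff_pow, ex_total_diff_mult;
    [apply ex_total_diff_const | apply ex_total_diff_inv_circle_pt].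
Qed.

(** Expanding the kernel as 1 + q + ... + q^n + q^(n+1) kernel with q = a / z. *)
Lemma remainder_formula a n : Cmod a < rho ->
  CInt (fun t => (h (circle_pt t) - h a) * kernel a t * (a * / circle_pt t) ^ S n)%C 0 (2 * PI)
  = ((2 * PI)%R * (h a - taylor a (S n)))%C.
Proof.
intros ha; assert (hpi := PI_RGT_0).
assert (twopi : RtoC (2 * PI) <> 0) by (intros e; apply RtoC_inj in e; lra).
assert (term : forall m,
  CInt (fun t => (h (circle_pt t) - h a) * (a * / circle_pt t) ^ m)%C 0 (2 * PI)
  = ((2 * PI)%R * (coef m * a ^ m) - h a * CInt (fun t => (a * / circle_pt t) ^ m)%C 0 (2 * PI))%C).
{ intros m.
  rewrite (CInt_ext _ (fun t => a ^ m * (h (circle_pt t) * (/ circle_pt t) ^ m)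
      - h a * (a * / circle_pt t) ^ m)%C)
    by (try lra; intros t _; rewrite !Cpow_mult_l; ring).
  rewrite CInt_minus; [| lra | |].
  - rewrite !CInt_Cmult by (try lra; intros t _; circle_continuity).
    unfold coef; field; auto.
  - intros t _; circle_continuity.
  - intros t _; circle_continuity. }
assert (step : forall m,
  CInt (fun t => (h (circle_pt t) - h a) * kernel a t * (a * / circle_pt t) ^ m)%C 0 (2 * PI)
  = (CInt (fun t => (h (circle_pt t) - h a) * (a * / circle_pt t) ^ m)%C 0 (2 * PI)
    + CInt (fun t => (h (circle_pt t) - h a) * kernel a t * (a * / circle_pt t) ^ S m)%C 0 (2 * PI))%C).
{ intros m; rewrite <- CInt_plus; [| lra | |].
  - apply CInt_ext; [lra |]; intros t _; unfold kernel; rewrite Cpow_S.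
    field; split; [apply circle_pt_nz | apply circle_pt_minus_nz; auto].
  - intros t _; circle_continuity.
  - intros t _; apply Ccont_remainder; auto. }
induction n as [| n IH].
- specialize (step 0%nat); rewrite term in step.
  rewrite (CInt_ext _ (fun t => (h (circle_pt t) - h a) * kernel a t)%C) in step
    by (try lra; intros t _; cbn [Cpow]; ring).
  rewrite Cauchy_difference in step by auto.
  rewrite (CInt_ext (fun t => (a * / circle_pt t) ^ 0)%C (fun _ => 1)), CInt_const in step
    by (try lra; reflexivity).
  rewrite Rminus_0_r in step; cbn [taylor].
  match goal with |- ?u = _ => match type of step with _ = (?v + _)%C =>
    replace u with ((v + u) - v)%C by ring; rewrite <- step; ring end end.
- specialize (step (S n)); rewrite IH, term in step.
  replace (CInt (fun t => (a * / circle_pt t) ^ S n)%C 0 (2 * PI)) with (RtoC 0) in step.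
  + change (taylor a (S (S n))) with (taylor a (S n) + coef (S n) * a ^ S n)%C.
    match goal with |- ?u = _ => match type of step with _ = (?v + _)%C =>
      replace u with ((v + u) - v)%C by ring; rewrite <- step; ring end end.
  + rewrite (CInt_ext _ (fun t => (a * / rho) ^ S n * (/ cis t) ^ S n)%C).
    * rewrite CInt_Cmult, CInt_inv_cis_pow, Cmult_0_r by (try lia; try lra;
        intros t _; apply (Ccont_snd (fun _ t => (/ cis t) ^ S n)%C 0);
        apply ex_total_diff_pow; eexists; eexists;
        exact (total_diff_comp Cinv _ _ _ _ _ _
          (is_Cderive_inv _ (cis_nz t)) (total_diff_cis 0 t))).
      reflexivity.
    * lra.
    * intros t _; rewrite <- Cpow_mult_l; f_equal; unfold circle_pt; field.
      split; [apply cis_nz | intros e; apply RtoC_inj in e; lra].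
Qed.

Lemma taylor_remainder M a n : Cmod a < rho ->
  (forall t, 0 <= t <= 2 * PI -> Cmod (h (circle_pt t)) <= M) ->
  Cmod (h a - taylor a (S n))
    <= (M + Cmod (h a)) * (rho / (rho - Cmod a)) * (Cmod a / rho) ^ S n.
Proof.
intros ha hM; assert (hpi := PI_RGT_0).
apply (Rmult_le_reg_l (2 * PI)); [lra |].
rewrite <- (Rabs_pos_eq (2 * PI)), <- Cmod_R, <- Cmod_mult, <- remainder_formula by (auto; lra).
rewrite Cmod_R, Rabs_pos_eq by lra.
replace (2 * PI) with (2 * PI - 0) at 2 by ring.
apply CInt_bound; [lra | intros t _; apply Ccont_remainder; auto |]; intros t ht.
rewrite !Cmod_mult, Cmod_pow, Cmod_mult, Cmod_inv, Cmod_circle_pt by apply circle_pt_nz.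
apply Rmult_le_compat_r.
{ apply pow_le, Rmult_le_pos; [apply Cmod_ge_0 | left; apply Rinv_0_lt_compat; auto]. }
apply Rmult_le_compat; auto using Cmod_ge_0, Cmod_kernel.
unfold Cminus; eapply Rle_trans; [apply Cmod_triangle |].
rewrite Cmod_opp; apply Rplus_le_compat_r; auto.
Qed.

Lemma circle_bound : exists M, forall t, 0 <= t <= 2 * PI -> Cmod (h (circle_pt t)) <= M.
Proof.
assert (hpi := PI_RGT_0).
destruct (continuity_ab_maj (fun t => Cmod (h (circle_pt t))) 0 (2 * PI)) as (m & hm & _);
  [lra | | exists (Cmod (h (circle_pt m))); exact hm].
intros t _; apply continuity_pt_filterlim.
assert (c := Ccont_on_circle t).
assert (n := filterlim_norm (V := C_R_NormedModule) (h (circle_pt t))).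
assert (k := filterlim_comp _ _ _ _ _ _ _ _ c n).
intros P hP.
generalize (k P); unfold filtermap; intros k'.
rewrite <- Cmod_norm in k'.
specialize (k' hP); revert k'; apply filter_imp; intros x hx.
rewrite Cmod_norm; exact hx.
Qed.

(** The constant Taylor coefficient is the mean of h over the circle. *)
Lemma mean_bound M : (forall t, 0 <= t <= 2 * PI -> Cmod (h (circle_pt t)) <= M) ->
  Cmod (h 0) <= M.
Proof.
intros hM; assert (hpi := PI_RGT_0).
assert (k := taylor_remainder M 0 0 ltac:(rewrite Cmod_0; lra) hM).
cbn [taylor Cpow pow] in k; rewrite Cmod_0 in k.
replace (0 / rho * 1) with 0 in k by (field; lra).
rewrite Rmult_0_r in k.
assert (e : h 0 = coef 0).
{ assert (z := Cmod_eq_0 _ (Rle_antisym _ _ k (Cmod_ge_0 _))).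
  replace (h 0) with ((h 0 - (0 + coef 0 * 1)) + coef 0)%C by ring; rewrite z; ring. }
rewrite e; unfold coef; rewrite Cmod_mult, Cmod_inv by (intros e'; apply RtoC_inj in e'; lra).
rewrite Cmod_R, Rabs_pos_eq by lra.
apply (Rmult_le_reg_l (2 * PI)); [lra |].
rewrite <- Rmult_assoc, Rinv_r, Rmult_1_l by lra.
replace (2 * PI) with (2 * PI - 0) at 2 by ring.
apply CInt_bound; [lra | |]; intros t ht.
- circle_continuity.
- cbn [Cpow]; rewrite Cmult_1_r; auto.
Qed.

(** If all the Taylor coefficients vanish, the remainder estimate forces h = 0 on the
    disc. Otherwise the first nonzero coefficient dominates near the origin. *)
Lemma zero_or_power_bound :
  (forall a, Cmod a < rho -> h a = 0) \/
  exists m beta delta, 0 < beta /\ 0 < delta /\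
    forall a, Cmod a < delta -> beta * Cmod a ^ m <= Cmod (h a).
Proof.
destruct circle_bound as [M hM].
assert (M0 : 0 <= M) by (exact (Rle_trans _ _ _ (Cmod_ge_0 _) (mean_bound M hM))).
destruct (classic (exists m, coef m <> 0)) as [hex | hnone].
- right.
  assert (least : exists m, coef m <> 0 /\ forall j, (j < m)%nat -> coef j = 0).
  { destruct hex as [m hm]; revert hm; pattern m; apply (well_founded_ind Nat.lt_wf_0).
    clear m; intros m IH hm.
    destruct (classic (exists j, (j < m)%nat /\ coef j <> 0)) as [(j & hj & nj) | no].
    - exact (IH j hj nj).
    - exists m; split; auto; intros j hj; apply NNPP; intros nj; apply no; eauto. }
  destruct least as (m & hm & hlow).
  assert (low : forall a k, (k <= m)%nat -> taylor a k = 0).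
  { intros a; induction k as [| k IH]; intros hk; [reflexivity |].
    cbn [taylor]; rewrite IH, hlow by lia; ring. }
  destruct (holo 0 ltac:(rewrite Cmod_0; lra)) as [l hl].
  destruct (is_Cderive_continuous h 0 l hl 1 Rlt_0_1) as (d1 & d1pos & hd1).
  set (b := Cmod (coef m)); assert (b0 : 0 < b) by (apply Cmod_gt_0; auto).
  (* E |a|^(m+1) bounds the remainder where |a| <= rho / 2 and |h a| <= |h 0| + 1, since
     then rho / (rho - |a|) <= 2. *)
  set (E := (M + (Cmod (h 0) + 1)) * 2 * / rho ^ S m).
  assert (pr : 0 < rho ^ S m) by (apply pow_lt; auto).
  assert (E0 : 0 < E).
  { assert (h0 := Cmod_ge_0 (h 0)); apply Rmult_lt_0_compat;
      [lra | apply Rinv_0_lt_compat; auto]. }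
  exists m, (b / 2), (Rmin (rho / 2) (Rmin d1 (b / (2 * E)))).
  split; [lra | split].
  { repeat apply Rmin_pos; auto; [lra | apply Rdiv_lt_0_compat; lra]. }
  intros a ha.
  assert (r1 := Rmin_l (rho / 2) (Rmin d1 (b / (2 * E)))).
  assert (r2 := Rmin_r (rho / 2) (Rmin d1 (b / (2 * E)))).
  assert (r3 := Rmin_l d1 (b / (2 * E))); assert (r4 := Rmin_r d1 (b / (2 * E))).
  assert (k := taylor_remainder M a m ltac:(lra) hM).
  cbn [taylor] in k; rewrite (low a m) in k by lia; rewrite Cplus_0_l in k.
  assert (a0 := Cmod_ge_0 a).
  assert (ca : Cmod (h a) <= Cmod (h 0) + 1).
  { assert (c := hd1 a); unfold Cminus in c at 1; rewrite Copp_0, Cplus_0_r in c.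
    specialize (c ltac:(lra)).
    assert (t := Cmod_triangle (h a - h 0) (h 0)).
    replace (h a - h 0 + h 0)%C with (h a) in t by ring; lra. }
  assert (kb : (M + Cmod (h a)) * (rho / (rho - Cmod a)) * (Cmod a / rho) ^ S m
                <= E * Cmod a ^ S m).
  { unfold Rdiv at 2; rewrite Rpow_mult_distr, pow_inv.
    replace (E * Cmod a ^ S m) with
      ((M + (Cmod (h 0) + 1)) * 2 * (Cmod a ^ S m * / rho ^ S m)) by (unfold E; ring).
    apply Rmult_le_compat_r.
    - apply Rmult_le_pos; [apply pow_le; auto | left; apply Rinv_0_lt_compat; auto].
    - apply Rmult_le_compat.
      + assert (h0 := Cmod_ge_0 (h a)); lra.
      + left; apply Rdiv_lt_0_compat; lra.
      + lra.
      + apply (Rmult_le_reg_r (rho - Cmod a)); [lra |].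
        unfold Rdiv; rewrite Rmult_assoc, Rinv_l by lra; lra. }
  assert (t := Cmod_triangle (h a) (- (h a - coef m * a ^ m))).
  replace (h a + - (h a - coef m * a ^ m))%C with (coef m * a ^ m)%C in t by ring.
  rewrite Cmod_opp, Cmod_mult, Cmod_pow in t; fold b in t.
  assert (pa : 0 <= Cmod a ^ m) by (apply pow_le; auto).
  assert (E * Cmod a ^ S m <= b / 2 * Cmod a ^ m).
  { cbn [pow]; rewrite <- Rmult_assoc; apply Rmult_le_compat_r; auto.
    apply (Rle_trans _ (E * (b / (2 * E)))); [apply Rmult_le_compat_l; lra |].
    right; field; lra. }
  lra.
- left; intros a ha.
  assert (a0 := Cmod_ge_0 a).
  assert (zero : forall n, taylor a n = 0).
  { induction n as [| n IH]; [reflexivity |]; cbn [taylor]; rewrite IH.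
    assert (coef n = 0) as ->; [apply NNPP; intros nz; apply hnone; eauto | ring]. }
  apply Cmod_eq_0, Rle_antisym; [| apply Cmod_ge_0].
  set (K := (M + Cmod (h a)) * (rho / (rho - Cmod a))).
  assert (K0 : 0 <= K).
  { apply Rmult_le_pos; [assert (h0 := Cmod_ge_0 (h a)); lra |].
    left; apply Rdiv_lt_0_compat; lra. }
  apply le_epsilon; intros eps e0; rewrite Rplus_0_l.
  destruct (pow_lt_1_zero (Cmod a / rho)) with (y := eps / (K + 1)) as [N hN].
  { rewrite Rabs_pos_eq.
    - apply (Rmult_lt_reg_r rho); auto; unfold Rdiv; rewrite Rmult_assoc, Rinv_l; lra.
    - apply Rmult_le_pos; [auto | left; apply Rinv_0_lt_compat; auto]. }
  { apply Rdiv_lt_0_compat; lra. }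
  specialize (hN (S N) ltac:(lia)).
  assert (k := taylor_remainder M a N ha hM); rewrite zero in k; fold K in k.
  replace (h a - 0)%C with (h a) in k by ring.
  assert (le := Rle_abs ((Cmod a / rho) ^ S N)).
  apply (Rle_trans _ _ _ k), (Rle_trans _ (K * (eps / (K + 1)))).
  + apply Rmult_le_compat_l; lra.
  + apply (Rle_trans _ ((K + 1) * (eps / (K + 1)))); [| right; field; lra].
    apply Rmult_le_compat_r; [left; apply Rdiv_lt_0_compat |]; lra.
Qed.

End Cauchy.

(** * Isolated zeros, the identity theorem and the minimum modulus *)

Definition holo_on_disc (h : C -> C) (c : C) (r : R) : Prop :=
  forall z, Cmod (z - c) < r -> exists l, is_Cderive h z l.

Lemma holo_recentre h c r : holo_on_disc h c r ->
  forall z, Cmod z < r -> exists l, is_Cderive (fun w => h (c + w)%C) z l.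
Proof.
intros hh z hz; destruct (hh (c + z)%C) as [l hl].
{ replace (c + z - c)%C with z by ring; exact hz. }
eexists; exact (is_Cderive_comp h (fun w => c + w)%C z _ _ hl
  (is_Cderive_plus _ _ _ _ _ (is_Cderive_const c z) (is_Cderive_id z))).
Qed.

Lemma center_le_circle h c r rho M : holo_on_disc h c r -> 0 < rho < r ->
  (forall z, Cmod (z - c) = rho -> Cmod (h z) <= M) -> Cmod (h c) <= M.
Proof.
intros hh [h0 hr] hM.
assert (k := mean_bound _ _ _ (holo_recentre _ _ _ hh) h0 hr M).
cbn beta in k; rewrite Cplus_0_r in k; apply k; intros t _; apply hM.
replace (c + circle_pt rho t - c)%C with (circle_pt rho t) by ring; apply Cmod_circle_pt; auto.
Qed.

Lemma isolated_zero h c r : holo_on_disc h c r ->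
  (forall z, Cmod (z - c) < r -> h z = 0) \/
  exists m beta delta, 0 < beta /\ 0 < delta /\
    forall z, Cmod (z - c) < delta -> beta * Cmod (z - c) ^ m <= Cmod (h z).
Proof.
intros hh.
destruct (classic (exists m beta delta, 0 < beta /\ 0 < delta /\
    forall z, Cmod (z - c) < delta -> beta * Cmod (z - c) ^ m <= Cmod (h z)))
  as [ex | no]; [right; exact ex | left; intros z hz].
assert (z0 := Cmod_ge_0 (z - c)).
destruct (zero_or_power_bound _ r ((Cmod (z - c) + r) / 2)
  (holo_recentre _ _ _ hh) ltac:(lra) ltac:(lra)) as [zero | (m & b & d & b0 & d0 & hd)].
- specialize (zero (z - c)%C ltac:(lra)).
  replace (c + (z - c))%C with z in zero by ring; exact zero.
- destruct no; exists m, b, d; repeat split; auto; intros w hw.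
  specialize (hd (w - c)%C hw); replace (c + (w - c))%C with w in hd by ring; exact hd.
Qed.

Definition vanishes_near (h : C -> C) (c : C) : Prop :=
  exists delta, 0 < delta /\ forall z, Cmod (z - c) < delta -> h z = 0.

(** A lower bound by a power of the distance excludes zeros close to c. *)
Lemma accumulating_zeros h c r : holo_on_disc h c r ->
  (forall delta, 0 < delta ->
     exists z, 0 < Cmod (z - c) < delta /\ h z = 0) ->
  forall z, Cmod (z - c) < r -> h z = 0.
Proof.
intros hh acc; destruct (isolated_zero h c r hh) as [z | (m & b & d & b0 & d0 & hd)];
  [exact z | exfalso].
destruct (acc d d0) as (z & [z0 zd] & hz).
specialize (hd z zd); rewrite hz, Cmod_0 in hd.
assert (p := pow_lt _ m z0); nra.
Qed.

Lemma small_real delta : 0 < delta ->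
  forall c, 0 < Cmod (c + (delta / 2)%R - c) < delta.
Proof.
intros d0 c; replace (c + (delta / 2)%R - c)%C with (RtoC (delta / 2)) by ring.
rewrite Cmod_R, Rabs_pos_eq; lra.
Qed.

Lemma vanishes_near_disc h c r : holo_on_disc h c r -> vanishes_near h c ->
  forall z, Cmod (z - c) < r -> h z = 0.
Proof.
intros hh (d & d0 & hd); apply accumulating_zeros; auto; intros e e0.
assert (m0 : 0 < Rmin d e) by (apply Rmin_pos; auto).
destruct (small_real (Rmin d e) m0 c) as [k1 k2].
assert (l := Rmin_l d e); assert (l' := Rmin_r d e).
eexists; split; [split; [exact k1 |] | apply hd]; lra.
Qed.

Lemma identity_real h r : holo_on_disc h 0 r ->
  (forall t : R, Rabs t < r -> h t = 0) -> forall z, Cmod z < r -> h z = 0.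
Proof.
intros hh ht z hz; assert (z0 := Cmod_ge_0 z).
assert (e : forall w : C, (w - 0)%C = w) by (intros; ring).
apply (accumulating_zeros h 0 r hh); [| rewrite e; exact hz].
intros d d0; assert (m0 : 0 < Rmin d r) by (apply Rmin_pos; lra).
assert (l := Rmin_l d r); assert (l' := Rmin_r d r).
exists (RtoC (Rmin d r / 2)); rewrite e, Cmod_R, Rabs_pos_eq by lra.
split; [lra | apply ht; rewrite Rabs_pos_eq; lra].
Qed.

Lemma holo_sub_disc h r c r' : holo_on_disc h 0 r -> Cmod c + r' <= r ->
  holo_on_disc h c r'.
Proof.
intros hh hc z hz; apply hh.
replace (z - 0)%C with ((z - c) + c)%C by ring.
eapply Rle_lt_trans; [apply Cmod_triangle | lra].
Qed.

(** The points p k subdivide the segment from c to the origin into steps shorter than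
    d = r - |c|. Each disc of radius d around p k lies in the disc of radius r and contains
    a neighbourhood of p (S k), so that vanishing propagates to the centre. *)
Lemma identity_local h r c : holo_on_disc h 0 r -> Cmod c < r ->
  vanishes_near h c -> forall z, Cmod z < r -> h z = 0.
Proof.
intros hh hc hv; set (d := r - Cmod c); assert (d0 : 0 < d) by (unfold d; lra).
assert (c0 := Cmod_ge_0 c).
destruct (Rle_lt_or_eq_dec 0 _ c0) as [cpos | czero].
2: { assert (c = 0) by (apply Cmod_eq_0; auto); subst c; intros z hz.
     apply (vanishes_near_disc h 0 r); auto; replace (z - 0)%C with z by ring; auto. }
destruct (archimed_cor1 (d / Cmod c)) as (N & hN & N0).
{ apply Rdiv_lt_0_compat; lra. }
assert (N1 : 0 < INR N) by (apply lt_0_INR; auto).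
set (p k := ((1 - INR k / INR N)%R * c)%C).
assert (step_lt : Cmod c / INR N < d).
{ apply (Rmult_lt_compat_r (Cmod c)) in hN; auto.
  replace (d / Cmod c * Cmod c) with d in hN by (field; lra).
  unfold Rdiv; rewrite Rmult_comm; exact hN. }
assert (walk : forall k, (k <= N)%nat -> vanishes_near h (p k)).
{ induction k as [| k IH]; intros hk.
  - unfold p; replace ((1 - INR 0 / INR N)%R * c)%C with c; [exact hv |].
    cbn [INR]; replace (1 - 0 / INR N) with 1 by (field; lra); ring.
  - assert (kN : 0 <= INR k / INR N <= 1).
    { split.
      - apply Rmult_le_pos; [apply pos_INR | left; apply Rinv_0_lt_compat; auto].
      - apply (Rmult_le_reg_r (INR N)); auto; unfold Rdiv.
        rewrite Rmult_assoc, Rinv_l, Rmult_1_l, Rmult_1_r by lra; apply le_INR; lia. }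
    assert (mp : Cmod (p k) <= Cmod c).
    { unfold p; rewrite Cmod_mult, Cmod_R, Rabs_pos_eq by lra; nra. }
    assert (van := vanishes_near_disc h (p k) d
       (holo_sub_disc h r (p k) d hh ltac:(unfold d; lra)) (IH ltac:(lia))).
    exists (d - Cmod c / INR N); split; [lra |]; intros z hz; apply van.
    replace (z - p k)%C with ((z - p (S k)) + (p (S k) - p k))%C by ring.
    eapply Rle_lt_trans; [apply Cmod_triangle |].
    replace (p (S k) - p k)%C with ((- / INR N)%R * c)%C.
    + rewrite (Cmod_mult (RtoC _)), Cmod_R, Rabs_Ropp, Rabs_pos_eq
        by (left; apply Rinv_0_lt_compat; auto).
      unfold Rdiv in hz; lra.
    + unfold p; rewrite S_INR.
      replace (- / INR N) with ((1 - (INR k + 1) / INR N) - (1 - INR k / INR N))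
        by (field; lra).
      rewrite !RtoC_minus; ring. }
assert (pN : p N = 0).
{ unfold p; replace (1 - INR N / INR N) with 0 by (field; lra); ring. }
specialize (walk N (le_n N)); rewrite pN in walk; intros z hz.
apply (vanishes_near_disc h 0 r); auto; replace (z - 0)%C with z by ring; auto.
Qed.

(** The minimum modulus principle, in the form used to follow zeros under perturbation:
    otherwise / h would be holomorphic and larger at c than on the circle. *)
Lemma zero_in_disc h c r rho mu : holo_on_disc h c r -> 0 < rho < r ->
  (forall z, Cmod (z - c) = rho -> mu <= Cmod (h z)) -> Cmod (h c) < mu ->
  exists z, Cmod (z - c) < r /\ h z = 0.
Proof.
intros hh hr hmu hc; apply NNPP; intros no.
assert (nz : forall z, Cmod (z - c) < r -> h z <> 0) by (intros z hz e; apply no; eauto).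
assert (mu0 : 0 < mu) by (assert (k := Cmod_ge_0 (h c)); lra).
assert (cc : Cmod (c - c) < r).
{ replace (c - c)%C with (RtoC 0) by ring; rewrite Cmod_0; lra. }
assert (k := center_le_circle (fun z => / h z)%C c r rho (/ mu)).
cbn beta in k; rewrite Cmod_inv in k by auto.
apply Rlt_not_le with (1 := Rinv_lt_contravar _ _
  (Rmult_lt_0_compat _ _ (proj1 (Cmod_gt_0 _) (nz c cc)) mu0) hc), k; auto.
- intros z hz; destruct (hh z hz) as [l hl]; eexists.
  exact (is_Cderive_comp Cinv h z _ _ (is_Cderive_inv _ (nz z hz)) hl).
- intros z hz; rewrite Cmod_inv by (apply nz; lra).
  apply Rinv_le_contravar; auto.
Qed.

(** * Quaternions, imaginary units and slices *)

Lemma H_ext (a b c d a' b' c' d' : R) :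
  a = a' -> b = b' -> c = c' -> d = d' -> (a, b, c, d) = (a', b', c', d') :> H.
Proof. intros -> -> -> ->; reflexivity. Qed.

Definition Hinner (p q : H) : R :=
  let '(a1, b1, c1, d1) := p in
  let '(a2, b2, c2, d2) := q in a1 * a2 + b1 * b2 + c1 * c2 + d1 * d2.

Ltac Hcoords := repeat match goal with
  | q : H |- _ => destruct q as [[[? ?] ?] ?]
  | q : (R * R * R * R)%type |- _ => destruct q as [[[? ?] ?] ?]
  end.
Ltac Hsimpl := unfold slice_pt, RtoH;
  repeat (progress (unfold minus, plus, opp, scal, mult, one, zero,
    prod_plus, prod_opp, prod_scal; cbn)).
Ltac Hring := intros; Hcoords; Hsimpl; try (apply H_ext); try ring.

Lemma Hmod_sqr (q : H) : Hmod q ^ 2 = Hinner q q.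
Proof.
destruct q as [[[a b] c] d]; unfold Hmod, Hinner.
rewrite pow2_sqrt; [ring |].
repeat apply Rplus_le_le_0_compat; apply pow2_ge_0.
Qed.

Lemma Hmod_ge_0 (q : H) : 0 <= Hmod q.
Proof. destruct q as [[[a b] c] d]; apply sqrt_pos. Qed.

Lemma Hmod_mult (p q : H) : Hmod (Hmult p q) = Hmod p * Hmod q.
Proof.
apply Rsqr_inj; [apply Hmod_ge_0 | apply Rmult_le_pos; apply Hmod_ge_0 |].
rewrite Rsqr_mult, !Rsqr_pow2, !Hmod_sqr; Hring.
Qed.

Lemma Hmod_plus (p q : H) : Hmod (plus p q) <= Hmod p + Hmod q.
Proof. rewrite !Hmod_norm; exact (norm_triangle p q). Qed.

Lemma Hmod_opp (p : H) : Hmod (opp p) = Hmod p.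
Proof. rewrite !Hmod_norm; exact (norm_opp p). Qed.

Lemma Hmod_minus (p q : H) : Hmod (minus p q) <= Hmod p + Hmod q.
Proof. rewrite <- (Hmod_opp q); apply Hmod_plus. Qed.

Lemma Hmod_le_minus (p q : H) : Hmod p <= Hmod (minus p q) + Hmod q.
Proof.
replace p with (plus (minus p q) q) at 1 by Hring; apply Hmod_plus.
Qed.

Lemma Hmod_scal (t : R) (q : H) : Hmod (scal t q) = Rabs t * Hmod q.
Proof.
apply Rsqr_inj; [apply Hmod_ge_0 | apply Rmult_le_pos; [apply Rabs_pos | apply Hmod_ge_0] |].
rewrite Rsqr_mult, <- Rsqr_abs, !Rsqr_pow2, !Hmod_sqr; Hring.
Qed.

Lemma Hmod_eq_0 (q : H) : Hmod q = 0 -> q = RtoH 0.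
Proof.
intros h; assert (k := Hmod_sqr q); rewrite h in k.
destruct q as [[[a b] c] d]; cbn in k; apply H_ext; nra.
Qed.

Lemma Hinner_le (p q : H) : Rabs (Hinner p q) <= Hmod p * Hmod q.
Proof.
rewrite <- (Rabs_pos_eq (Hmod p * Hmod q))
  by (apply Rmult_le_pos; apply Hmod_ge_0).
apply Rsqr_le_abs_0; rewrite Rsqr_mult, !Rsqr_pow2, !Hmod_sqr.
destruct p as [[[a1 b1] c1] d1], q as [[[a2 b2] c2] d2]; cbn [Hinner].
assert (0 <= (a1 * b2 - b1 * a2) ^ 2 + (a1 * c2 - c1 * a2) ^ 2 + (a1 * d2 - d1 * a2) ^ 2
  + (b1 * c2 - c1 * b2) ^ 2 + (b1 * d2 - d1 * b2) ^ 2 + (c1 * d2 - d1 * c2) ^ 2)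
  by (repeat apply Rplus_le_le_0_compat; apply pow2_ge_0).
nra.
Qed.

(** If the real part a were not 0, the relations 2ax = 2ay = 2az = 0 would leave a^2 = -1. *)
Lemma imag_unit_coords (I : H) : imag_unit I ->
  exists x y z, I = (0, x, y, z) /\ x ^ 2 + y ^ 2 + z ^ 2 = 1.
Proof.
destruct I as [[[a x] y] z]; intros e; injection e; intros e3 e2 e1 e0.
assert (a = 0) as ->; [| exists x, y, z; split; [reflexivity | nra]].
destruct (Req_dec a 0); auto.
assert (x = 0) by (apply (Rmult_eq_reg_l a); lra).
assert (y = 0) by (apply (Rmult_eq_reg_l a); lra).
assert (z = 0) by (apply (Rmult_eq_reg_l a); lra).
subst; nra.
Qed.

Lemma imag_unit_intro (x y z : R) : x ^ 2 + y ^ 2 + z ^ 2 = 1 -> imag_unit (0, x, y, z).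
Proof. intros e; unfold imag_unit; cbn; apply H_ext; nra. Qed.

Lemma Hmod_imag_unit (I : H) : imag_unit I -> Hmod I = 1.
Proof.
intros hI; destruct (imag_unit_coords I hI) as (x & y & z & -> & e).
unfold Hmod; rewrite <- sqrt_1; f_equal; lra.
Qed.

Definition slice (I : H) (z : C) : H := slice_pt I (Re z) (Im z).

Lemma slice_minus I z w : minus (slice I w) (slice I z) = slice I (w - z)%C.
Proof. destruct z as [x y], w as [u v]; unfold slice; Hring. Qed.

Lemma Hmod_slice I z : imag_unit I -> Hmod (slice I z) = Cmod z.
Proof.
intros hI; destruct (imag_unit_coords I hI) as (x & y & t & -> & e).
destruct z as [u v]; unfold slice, Cmod, Hmod; Hsimpl; f_equal; nra.
Qed.

Lemma slice_decomposition (q : H) : exists I z, imag_unit I /\ q = slice I z.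
Proof.
destruct q as [[[a b] c] d].
set (n := sqrt (b ^ 2 + c ^ 2 + d ^ 2)).
assert (n2 : n ^ 2 = b ^ 2 + c ^ 2 + d ^ 2).
{ apply pow2_sqrt; repeat apply Rplus_le_le_0_compat; apply pow2_ge_0. }
destruct (Req_dec n 0) as [n0 | n0].
- exists (0, 1, 0, 0), (a, 0); split; [apply imag_unit_intro; ring |].
  rewrite n0 in n2; unfold slice; Hsimpl; apply H_ext; nra.
- exists (0, b / n, c / n, d / n), (a, n); split.
  + apply imag_unit_intro; transitivity ((b ^ 2 + c ^ 2 + d ^ 2) / n ^ 2); [| rewrite <- n2]; field; auto.
  + unfold slice; Hsimpl; apply H_ext; field; auto.
Qed.

(** The pairing with p made complex linear: slice_coord I p (I q) = i slice_coord I p q,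
    with real part the inner product of q and p. Complex analysis on the slice of I is
    reduced to scalar functions through these coordinates. *)
Definition slice_coord (I p q : H) : C := (Hinner q p, - Hinner (Hmult I q) p).

Lemma slice_coord_minus (I p q q' : H) : slice_coord I p (minus q q') = (slice_coord I p q - slice_coord I p q')%C.
Proof. unfold slice_coord; apply injective_projections; Hring. Qed.

Lemma slice_coord_slice (I p q : H) (z : C) : imag_unit I ->
  slice_coord I p (Hmult (slice I z) q) = (z * slice_coord I p q)%C.
Proof.
intros hI; destruct (imag_unit_coords I hI) as (x & y & t & -> & e).
destruct z as [u v]; Hcoords; unfold slice.
apply injective_projections; Hsimpl; [ring |].
assert (x2 : x * x = 1 - y * y - t * t) by nra; ring [x2].
Qed.

Lemma Cmod_slice_coord I p q : imag_unit I -> Cmod (slice_coord I p q) <= 2 * Hmod p * Hmod q.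
Proof.
intros hI; replace (slice_coord I p q) with
  (RtoC (Hinner q p) + Ci * RtoC (- Hinner (Hmult I q) p))%C
  by (apply injective_projections; cbn; ring).
eapply Rle_trans; [apply Cmod_triangle |].
rewrite Cmod_mult, Cmod_Ci, !Cmod_R, Rabs_Ropp.
assert (h1 := Hinner_le q p); assert (h2 := Hinner_le (Hmult I q) p).
rewrite Hmod_mult, Hmod_imag_unit in h2 by auto; lra.
Qed.

Definition Hone : H := (1, 0, 0, 0).
Definition Hi : H := (0, 1, 0, 0).
Definition Hj : H := (0, 0, 1, 0).
Definition Hk : H := (0, 0, 0, 1).

Lemma Hi_unit : imag_unit Hi.
Proof. apply imag_unit_intro; ring. Qed.

Lemma slice_real (I : H) (t : R) : slice I t = RtoH t.
Proof. unfold slice; Hring. Qed.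

Lemma Hinner_mult_unit I p q : imag_unit I ->
  Hinner (Hmult I q) p = - Hinner q (Hmult I p).
Proof.
intros hI; destruct (imag_unit_coords I hI) as (x & y & t & -> & _); clear; Hring.
Qed.

Definition H_NormedModule : NormedModule R_AbsRing :=
  prod_NormedModule _ (prod_NormedModule _ (prod_NormedModule _
    R_NormedModule R_NormedModule) R_NormedModule) R_NormedModule.

Lemma H_ball_of_Hmod (q q' : H) (eps : R) :
  Hmod (minus q' q) < eps -> ball q eps q'.
Proof.
rewrite Hmod_norm; exact (norm_compat1 (K := R_AbsRing) (V := H_NormedModule) q q' eps).
Qed.

Lemma Hmod_le_coords (a b c d : R) : Hmod (a, b, c, d) <= Rabs a + Rabs b + Rabs c + Rabs d.
Proof.
assert (t0 := Rabs_pos a); assert (t1 := Rabs_pos b).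
assert (t2 := Rabs_pos c); assert (t3 := Rabs_pos d).
apply Rsqr_incr_0_var; [| lra].
rewrite Rsqr_pow2, Hmod_sqr; cbn [Hinner].
fold (Rsqr a) (Rsqr b) (Rsqr c) (Rsqr d); rewrite (Rsqr_abs a), (Rsqr_abs b),
  (Rsqr_abs c), (Rsqr_abs d); unfold Rsqr.
generalize dependent (Rabs a); generalize dependent (Rabs b).
generalize dependent (Rabs c); generalize dependent (Rabs d).
intros x x0 y y0 z z0 t t0'.
assert (0 <= x * y /\ 0 <= x * z /\ 0 <= x * t /\ 0 <= y * z /\ 0 <= y * t /\ 0 <= z * t)
  by (repeat split; apply Rmult_le_pos; auto).
lra.
Qed.

Lemma Hmod_lt_of_ball (q q' : H) (eps : R) : ball q eps q' -> Hmod (minus q' q) < 4 * eps.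
Proof.
destruct q as [[[a b] c] d], q' as [[[a' b'] c'] d'].
intros [[[h0 h1] h2] h3].
apply (Rle_lt_trans _ _ _ (Hmod_le_coords (a' - a) (b' - b) (c' - c) (d' - d))).
change (Rabs (a' - a) < eps) in h0; change (Rabs (b' - b) < eps) in h1.
change (Rabs (c' - c) < eps) in h2; change (Rabs (d' - d) < eps) in h3; lra.
Qed.

(** For z0 real the second term vanishes: all imaginary units then give the same point. *)
Lemma slice_close (I I0 : H) (z z0 : C) : imag_unit I ->
  Hmod (minus (slice I z) (slice I0 z0)) <= Cmod (z - z0) + Rabs (Im z0) * Hmod (minus I I0).
Proof.
intros hI; rewrite <- (Hmod_slice I), <- Hmod_scal, <- slice_minus by auto.
replace (minus (slice I z) (slice I0 z0)) with
  (plus (minus (slice I z) (slice I z0)) (scal (Im z0) (minus I I0)))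
  by (clear; destruct z, z0; unfold slice; Hring).
apply Hmod_plus.
Qed.


(** * Regular functions on slices and their stem function *)

Lemma filterdiff_H_eps (f : H -> H) (q : H) (L : H -> H) :
  filterdiff (K := R_AbsRing) f (locally q) L ->
  forall eps, 0 < eps -> exists delta, 0 < delta /\ forall q' : H,
    Hmod (minus q' q) < delta ->
    Hmod (minus (minus (f q') (f q)) (L (minus q' q))) <= eps * Hmod (minus q' q).
Proof.
intros [_ h] eps e0.
destruct (h q (fun _ hP => hP) (mkposreal eps e0)) as [d hd].
exists d; split; [apply cond_pos |]; intros q' hq.
rewrite !Hmod_norm; apply hd, H_ball_of_Hmod, hq.
Qed.

Lemma directional_derivative (f : H -> H) (p : R -> H) (L : H -> H) (t0 : R) (v d : H) :
  filterdiff (K := R_AbsRing) f (locally (p t0)) L ->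
  (forall t, minus (p t) (p t0) = scal (t - t0) v) ->
  is_derive (K := R_AbsRing) (fun t => f (p t)) t0 d -> d = L v.
Proof.
intros hf hp [_ hd].
assert (zero : Hmod (minus d (L v)) = 0); [| apply Hmod_eq_0 in zero].
2: { replace d with (plus (minus d (L v)) (L v)); [rewrite zero |].
     - generalize (L v); Hring.
     - generalize (L v); Hring. }
apply Rle_antisym; [| apply Hmod_ge_0]; apply le_epsilon; intros eps e0.
rewrite Rplus_0_l.
assert (v0 := Hmod_ge_0 v).
set (e := eps / (1 + Hmod v)); assert (epos : 0 < e) by (apply Rdiv_lt_0_compat; lra).
destruct (hd t0 (fun _ hP => hP) (mkposreal e epos)) as [d1 h1].
destruct (filterdiff_H_eps f (p t0) L hf e epos) as (d2 & d2pos & h2).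
set (s := Rmin (d1 / 2) (d2 / (2 * (1 + Hmod v)))).
assert (s0 : 0 < s).
{ apply Rmin_pos; [assert (k := cond_pos d1); lra | apply Rdiv_lt_0_compat; lra]. }
assert (m1 := Rmin_l (d1 / 2) (d2 / (2 * (1 + Hmod v)))).
assert (m2 := Rmin_r (d1 / 2) (d2 / (2 * (1 + Hmod v)))).
fold s in m1, m2.
assert (k1 : Hmod (minus (minus (f (p (t0 + s))) (f (p t0))) (scal s d)) <= e * s).
{ rewrite Hmod_norm; specialize (h1 (t0 + s)); cbv beta in h1.
  assert (ts : minus (G := R_AbelianGroup) (t0 + s) t0 = s)
    by (unfold minus, plus, opp; cbn; ring).
  assert (near : Rabs (minus (G := R_AbelianGroup) (t0 + s) t0) < d1).
  { rewrite ts, Rabs_pos_eq; assert (k := cond_pos d1); lra. }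
  specialize (h1 near).
  change (norm (K := R_AbsRing) (minus (minus (f (p (t0 + s))) (f (p t0)))
    (scal (K := R_AbsRing) (minus (G := R_AbelianGroup) (t0 + s) t0) d))
    <= e * Rabs (minus (G := R_AbelianGroup) (t0 + s) t0)) in h1.
  rewrite ts, (Rabs_pos_eq s) in h1 by lra; exact h1. }
assert (sv : Hmod (scal s v) = s * Hmod v) by (rewrite Hmod_scal, Rabs_pos_eq; lra).
assert (k2 : Hmod (minus (minus (f (p (t0 + s))) (f (p t0))) (scal s (L v)))
               <= e * (s * Hmod v)).
{ specialize (h2 (p (t0 + s))); rewrite hp in h2.
  replace (t0 + s - t0) with s in h2 by ring.
  rewrite (linear_scal L (proj1 hf)), sv in h2; apply h2.
  apply (Rle_lt_trans _ (d2 / (2 * (1 + Hmod v)) * Hmod v)).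
  - apply Rmult_le_compat_r; lra.
  - apply (Rmult_lt_reg_r (2 * (1 + Hmod v))); [lra |].
    replace (d2 / (2 * (1 + Hmod v)) * Hmod v * (2 * (1 + Hmod v)))
      with (d2 * Hmod v) by (field; lra).
    nra. }
apply (Rmult_le_reg_l s); auto.
rewrite <- (Rabs_pos_eq s) at 1 by lra; rewrite <- Hmod_scal.
replace (scal s (minus d (L v))) with
  (minus (minus (minus (f (p (t0 + s))) (f (p t0))) (scal s (L v)))
         (minus (minus (f (p (t0 + s))) (f (p t0))) (scal s d)))
  by (generalize (L v) (f (p (t0 + s))) (f (p t0)); Hring).
eapply Rle_trans; [apply Hmod_minus |].
apply (Rle_trans _ (s * (e * (1 + Hmod v)))); [nra |].
right; unfold e; field; lra.
Qed.

(** Regularity says that the real differential of f along the slice of I intertwines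
    multiplication by I, that is, f is complex differentiable there for the left structure. *)
Lemma slice_differential Omega f I z :
  regular_on Omega f -> imag_unit I -> Omega (slice I z) ->
  exists D : H, forall eps, 0 < eps -> exists delta, 0 < delta /\
    forall w, Cmod (w - z) < delta ->
      Hmod (minus (minus (f (slice I w)) (f (slice I z))) (Hmult (slice I (w - z)) D))
        <= eps * Cmod (w - z).
Proof.
intros [hdiff hcr] hI hz.
destruct (hdiff _ hz) as [L hL].
destruct (hcr I (Re z) (Im z) hI hz) as (dx & dy & hdx & hdy & cr).
assert (ex : dx = L (RtoH 1)).
{ apply (directional_derivative f (fun t => slice_pt I t (Im z)) L (Re z)); auto.
  clear; intros t; Hring. }
assert (ey : dy = L I).
{ apply (directional_derivative f (fun t => slice_pt I (Re z) t) L (Im z)); auto.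
  clear; intros t; Hring. }
exists dx; intros eps e0.
destruct (filterdiff_H_eps f _ L hL eps e0) as (d & d0 & hd).
exists d; split; auto; intros w hw.
assert (e := slice_minus I z w).
assert (n : Hmod (minus (slice I w) (slice I z)) = Cmod (w - z))
  by (rewrite e; apply Hmod_slice; auto).
specialize (hd (slice I w) ltac:(unfold slice at 2 in n; unfold slice at 2; rewrite n; exact hw)).
fold (slice I z) in hd; rewrite n in hd.
replace (Hmult (slice I (w - z)) dx) with (L (minus (slice I w) (slice I z))); auto.
rewrite e; generalize (w - z)%C; intros [u v].
unfold slice, slice_pt; cbn [Re Im fst snd].
rewrite (linear_plus L (proj1 hL)), (linear_scal L (proj1 hL)), <- ey.
replace (RtoH u) with (scal u (RtoH 1)) by (clear; Hring).
rewrite (linear_scal L (proj1 hL)), <- ex.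
(* The equation dx + I dy = 0, multiplied by I on the left. *)
assert (Idx : dy = Hmult I dx).
{ destruct (imag_unit_coords I hI) as (x & y & t & -> & n1).
  assert (x2 : x * x = 1 - y * y - t * t) by nra.
  assert (e1 : dx = opp (Hmult (0, x, y, t) dy)).
  { clear - cr; Hcoords; revert cr; Hsimpl; intros cr; injection cr; intros.
    apply H_ext; lra. }
  rewrite e1; clear - x2; Hring; ring [x2]. }
rewrite Idx; clear; Hring.
Qed.

Section Stem.

Variables (r : R) (f : H -> H).
Hypothesis regular : regular_on (Hball r) f.

Definition coordinate (I p : H) (z : C) : C := slice_coord I p (f (slice I z)).

Lemma coordinate_holo I p z : imag_unit I -> Cmod z < r ->
  exists l, is_Cderive (coordinate I p) z l.
Proof.
intros hI hz.
destruct (slice_differential _ f I z regular hI) as [D hD].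
{ unfold Hball; rewrite Hmod_slice; auto. }
exists (slice_coord I p D); apply is_Cderive_eps; intros eps e0.
assert (p0 := Hmod_ge_0 p).
destruct (hD (eps / (2 * Hmod p + 1))) as (d & d0 & hd).
{ apply Rdiv_lt_0_compat; lra. }
exists d; split; auto; intros w hw; specialize (hd w hw).
unfold coordinate; rewrite <- slice_coord_minus, <- slice_coord_slice, <- slice_coord_minus by auto.
eapply Rle_trans; [apply Cmod_slice_coord; auto |].
apply (Rle_trans _ ((2 * Hmod p + 1) * (eps / (2 * Hmod p + 1) * Cmod (w - z)))).
- apply Rmult_le_compat; auto using Hmod_ge_0; lra.
- right; field; lra.
Qed.

(** The holomorphic function whose real and imaginary parts at x + iy are the components
    along p of b and c, where f (x + yI) = b + I c. It is built from the slice of i only,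
    by solving for b and c with the values at x + yi and x - yi; the conjugate of a
    holomorphic function of the conjugate variable is holomorphic. *)
Definition stem (p : H) (z : C) : C :=
  ((coordinate Hi p z + Cconj (coordinate Hi p (Cconj z))) * / 2)%C.

Lemma stem_holo p : holo_on_disc (stem p) 0 r.
Proof.
intros z hz; replace (z - 0)%C with z in hz by ring.
destruct (coordinate_holo Hi p z Hi_unit hz) as [l hl].
destruct (coordinate_holo Hi p (Cconj z) Hi_unit ltac:(rewrite Cmod_conj; auto)) as [l' hl'].
eexists; exact (is_Cderive_mult _ _ _ _ _
  (is_Cderive_plus _ _ _ _ _ hl (is_Cderive_conj _ _ _ hl')) (is_Cderive_const (/ 2)%C z)).
Qed.

Lemma stem_real p (t : R) : stem p t = Hinner (f (RtoH t)) p.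
Proof.
unfold stem, coordinate.
replace (Cconj t) with (RtoC t) by (apply injective_projections; cbn; ring).
rewrite slice_real; unfold slice_coord; apply injective_projections; cbn; field.
Qed.

(** Both sides are real parts of holomorphic functions of z, coordinate I p and
    stem p + i stem (I p), which agree on the real axis because there the slice of I and
    the slice of i meet. *)
Lemma representation I p z : imag_unit I -> Cmod z < r ->
  Hinner (f (slice I z)) p = Re (stem p z) - Im (stem (Hmult I p) z).
Proof.
intros hI hz.
set (dev z := (coordinate I p z - (stem p z + Ci * stem (Hmult I p) z))%C).
assert (dev0 : dev z = 0).
{ apply (identity_real dev r); auto.
  - intros w hw; assert (hw' := hw); replace (w - 0)%C with w in hw' by ring.
    destruct (coordinate_holo I p w hI hw') as [l hl].
    destruct (stem_holo p w hw) as [l1 hl1].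
    destruct (stem_holo (Hmult I p) w hw) as [l2 hl2].
    eexists; apply is_Cderive_minus; [exact hl |].
    apply is_Cderive_plus; [exact hl1 |].
    apply is_Cderive_mult; [apply is_Cderive_const | exact hl2].
  - intros t _; unfold dev; rewrite !stem_real; unfold coordinate.
    rewrite slice_real; unfold slice_coord; rewrite Hinner_mult_unit by auto.
    generalize (Hinner (f (RtoH t)) p) (Hinner (f (RtoH t)) (Hmult I p)); intros u v.
    apply injective_projections; cbn; ring. }
assert (e : (coordinate I p z = stem p z + Ci * stem (Hmult I p) z)%C).
{ transitivity (dev z + (stem p z + Ci * stem (Hmult I p) z))%C;
    [unfold dev; ring | rewrite dev0; ring]. }
apply (f_equal Re) in e; unfold coordinate, slice_coord in e; revert e.
generalize (Hinner (f (slice I z)) p) (stem p z) (stem (Hmult I p) z).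
intros a [u v] [u' v']; cbn; lra.
Qed.


Lemma stem_linear (a b c d : R) z :
  stem (a, b, c, d) z
  = (a * stem Hone z + b * stem Hi z + c * stem Hj z + d * stem Hk z)%C.
Proof.
unfold stem, coordinate, slice_coord.
generalize (f (slice Hi z)) (f (slice Hi (Cconj z))).
intros p q; Hcoords; apply injective_projections; cbn; field.
Qed.

Definition even_part (z : C) : H :=
  (Re (stem Hone z), Re (stem Hi z), Re (stem Hj z), Re (stem Hk z)).
Definition odd_part (z : C) : H :=
  (Im (stem Hone z), Im (stem Hi z), Im (stem Hj z), Im (stem Hk z)).

(** Pair with the four basis vectors; since I is skew, pairing c with I p amounts to
    pairing - I c with p. *)
Lemma slice_formula I z : imag_unit I -> Cmod z < r ->
  f (slice I z) = plus (even_part z) (Hmult I (odd_part z)).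
Proof.
intros hI hz; assert (k := fun p => representation I p z hI hz).
destruct (imag_unit_coords I hI) as (x & y & t & -> & _).
assert (k0 := k Hone); assert (k1 := k Hi); assert (k2 := k Hj); assert (k3 := k Hk).
clear k; revert k0 k1 k2 k3; unfold even_part, odd_part.
unfold Hone, Hi, Hj, Hk; cbn [Hmult]; rewrite !stem_linear; fold Hone Hi Hj Hk.
generalize (f (slice (0, x, y, t) z)) (stem Hone z) (stem Hi z) (stem Hj z) (stem Hk z).
clear; intros q [u0 v0] [u1 v1] [u2 v2] [u3 v3]; Hcoords; unfold Hone, Hi, Hj, Hk; Hsimpl.
intros k0 k1 k2 k3; apply H_ext; lra.
Qed.

End Stem.

(** * The complexified norm *)

(** The complexification of the squared norm, at u + iv. *)
Definition norm_form (u v : H) : C := (Hinner u u - Hinner v v, 2 * Hinner u v).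

Lemma norm_form_of_root (u v I : H) :
  imag_unit I -> plus u (Hmult I v) = RtoH 0 -> norm_form u v = 0.
Proof.
intros hI; destruct (imag_unit_coords I hI) as (x & y & t & -> & n).
assert (x2 : x * x = 1 - y * y - t * t) by nra.
intros e; assert (eu : u = opp (Hmult (0, x, y, t) v)).
{ revert e; clear; Hcoords; Hsimpl; intros e; injection e; intros; apply H_ext; lra. }
rewrite eu; clear - x2; Hcoords; unfold norm_form; apply injective_projections; Hsimpl;
  ring [x2].
Qed.

(** Vanishing means that u and v are orthogonal of the same length. When v is not 0 the
    solution I = - u v^-1 then has real part 0 and modulus 1. *)
Lemma root_of_norm_form (u v : H) : norm_form u v = 0 ->
  exists I, imag_unit I /\ plus u (Hmult I v) = RtoH 0.
Proof.
intros e; injection e; intros h2 h1.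
destruct (Req_dec (Hinner v v) 0) as [v0 | v0].
- exists Hi; split; [apply Hi_unit |].
  assert (zero : forall q : H, Hinner q q = 0 -> q = RtoH 0).
  { intros q hq; apply Hmod_eq_0; apply Rsqr_inj; [apply Hmod_ge_0 | lra |].
    rewrite Rsqr_0, Rsqr_pow2, Hmod_sqr; exact hq. }
  rewrite (zero u), (zero v) by lra; clear; Hring.
- destruct u as [[[a b] c] d], v as [[[a' b'] c'] d']; cbn [Hinner] in *.
  set (n := a' * a' + b' * b' + c' * c' + d' * d') in *.
  (* The vector part of - u v^-1. *)
  exists (0, (a * b' - b * a' + c * d' - d * c') / n,
             (a * c' - b * d' - c * a' + d * b') / n,
             (a * d' + b * c' - c * b' - d * a') / n).
  assert (orth : a * a' + b * b' + c * c' + d * d' = 0) by lra.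
  split.
  + apply imag_unit_intro.
    transitivity (((a * a + b * b + c * c + d * d) * n
      - (a * a' + b * b' + c * c' + d * d') ^ 2) / n ^ 2).
    * unfold n; field; exact v0.
    * rewrite orth; replace (a * a + b * b + c * c + d * d) with n by lra.
      field; exact v0.
  + Hsimpl; apply H_ext;
      [ transitivity ((a * a' + b * b' + c * c' + d * d') * a' / n)
      | transitivity ((a * a' + b * b' + c * c' + d * d') * b' / n)
      | transitivity ((a * a' + b * b' + c * c' + d * d') * c' / n)
      | transitivity ((a * a' + b * b' + c * c' + d * d') * d' / n) ];
      solve [ unfold n; field; exact v0 | rewrite orth; unfold Rdiv; ring ].
Qed.

Lemma norm_form_shift (u d v : H) :
  Cmod (norm_form (plus u d) v - norm_form u v)
    <= Hmod d * (2 * Hmod u + Hmod d + 2 * Hmod v).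
Proof.
replace (norm_form (plus u d) v - norm_form u v)%C with
  (RtoC (Hinner d (plus (scal 2 u) d)) + Ci * RtoC (2 * Hinner d v))%C
  by (clear; Hcoords; apply injective_projections; unfold norm_form; Hsimpl; ring).
eapply Rle_trans; [apply Cmod_triangle |].
rewrite Cmod_mult, Cmod_Ci, !Cmod_R, Rabs_mult, (Rabs_pos_eq 2) by lra.
assert (k1 := Hinner_le d (plus (scal 2 u) d)); assert (k2 := Hinner_le d v).
assert (k3 := Hmod_plus (scal 2 u) d); rewrite Hmod_scal, (Rabs_pos_eq 2) in k3 by lra.
assert (d0 := Hmod_ge_0 d).
apply (Rle_trans _ (Hmod d * (2 * Hmod u + Hmod d) + 1 * (2 * (Hmod d * Hmod v))));
  [| right; ring].
apply Rplus_le_compat; [| lra].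
apply (Rle_trans _ _ _ k1), Rmult_le_compat_l; auto.
Qed.

(** * The open mapping theorem *)

Section Openness.

Variables (r : R) (f : H -> H).
Hypothesis regular : regular_on (Hball r) f.
Hypothesis r_pos : 0 < r.
Hypothesis nonconstant : forall x y : R, y <> 0 ->
  (forall q : H, sphere x y q -> Hball r q) -> ~ constant_on (sphere x y) f.

Let b := even_part f.
Let c := odd_part f.

(** Otherwise the affine function I -> b + I c would be constant. *)
Lemma odd_part_nz z : Cmod z < r -> Im z <> 0 -> 0 < Hmod (c z).
Proof.
intros hz hy; destruct (Rle_lt_or_eq_dec _ _ (Hmod_ge_0 (c z))) as [h | h]; auto.
exfalso; apply (nonconstant (Re z) (Im z) hy).
- intros q (I & hI & ->); unfold Hball.
  change (Hmod (slice I z) < r); rewrite Hmod_slice; auto.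
- exists (b z); intros q (I & hI & ->); change (f (slice I z) = b z).
  rewrite (slice_formula r) by auto; fold b c.
  rewrite (Hmod_eq_0 (c z)) by auto; generalize (b z); clear; Hring.
Qed.

(** The value at x + iy of the symmetrization of f - w: a holomorphic function that
    vanishes exactly when f takes the value w on the sphere x + yS. *)
Definition symmetrization (w : H) (z : C) : C := norm_form (minus (b z) w) (c z).

Lemma symmetrization_sum_of_squares (w0 w1 w2 w3 : R) z :
  symmetrization (w0, w1, w2, w3) z =
  ((stem f Hone z - w0) * (stem f Hone z - w0) + (stem f Hi z - w1) * (stem f Hi z - w1)
   + (stem f Hj z - w2) * (stem f Hj z - w2) + (stem f Hk z - w3) * (stem f Hk z - w3))%C.
Proof.
unfold symmetrization, b, c, even_part, odd_part.
generalize (stem f Hone z) (stem f Hi z) (stem f Hj z) (stem f Hk z).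
intros [? ?] [? ?] [? ?] [? ?]; unfold norm_form; apply injective_projections; Hsimpl; ring.
Qed.

Lemma symmetrization_holo w : holo_on_disc (symmetrization w) 0 r.
Proof.
intros z hz; destruct w as [[[w0 w1] w2] w3].
assert (sq : forall p (t : R), exists l,
  is_Cderive (fun z => (stem f p z - t) * (stem f p z - t))%C z l).
{ intros p t; destruct (stem_holo r f regular p z hz) as [l hl].
  assert (k := is_Cderive_minus _ _ _ _ _ hl (is_Cderive_const t z)).
  eexists; exact (is_Cderive_mult _ _ _ _ _ k k). }
destruct (sq Hone w0) as [l0 h0]; destruct (sq Hi w1) as [l1 h1].
destruct (sq Hj w2) as [l2 h2]; destruct (sq Hk w3) as [l3 h3].
assert (k := is_Cderive_plus _ _ _ _ _ (is_Cderive_plus _ _ _ _ _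
  (is_Cderive_plus _ _ _ _ _ h0 h1) h2) h3).
eexists; eapply is_derive_ext; [| exact k].
intros u; symmetry; apply symmetrization_sum_of_squares.
Qed.

(** By the identity theorem the symmetrization would vanish on the real axis, where it is
    |f - w|^2. Then f = w there, the stem function is constant, and f is constant on the
    spheres. *)
Lemma symmetrization_not_vanishing w z0 : Cmod z0 < r -> ~ vanishes_near (symmetrization w) z0.
Proof.
intros hz0 hv.
assert (zero := identity_local _ r z0 (symmetrization_holo w) hz0 hv).
destruct w as [[[w0 w1] w2] w3].
assert (real : forall t : R, Rabs t < r ->
  stem f Hone t = w0 /\ stem f Hi t = w1 /\ stem f Hj t = w2 /\ stem f Hk t = w3).
{ intros t ht; specialize (zero t ltac:(rewrite Cmod_R; exact ht)).
  rewrite symmetrization_sum_of_squares, !stem_real in zero; rewrite !stem_real.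
  revert zero; generalize (f (RtoH t)); intros [[[a a'] a''] a'''].
  unfold Hone, Hi, Hj, Hk; cbn [Hinner]; intros zero; apply (f_equal fst) in zero.
  assert (sum : (a - w0) ^ 2 + (a' - w1) ^ 2 + (a'' - w2) ^ 2 + (a''' - w3) ^ 2 = 0)
    by (etransitivity; [| exact zero]; cbn; ring).
  assert (p0 := pow2_ge_0 (a - w0)); assert (p1 := pow2_ge_0 (a' - w1)).
  assert (p2 := pow2_ge_0 (a'' - w2)); assert (p3 := pow2_ge_0 (a''' - w3)).
  assert (sq : forall s, s ^ 2 <= 0 -> s = 0) by (intros s hs; nra).
  assert (q0 := sq (a - w0) ltac:(lra)); assert (q1 := sq (a' - w1) ltac:(lra)).
  assert (q2 := sq (a'' - w2) ltac:(lra)); assert (q3 := sq (a''' - w3) ltac:(lra)).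
  repeat split; f_equal; lra. }
assert (const : forall p t0, (forall t : R, Rabs t < r -> stem f p t = RtoC t0) ->
  forall z, Cmod z < r -> Im (stem f p z) = 0).
{ intros p t0 ht z hz.
  assert (k := identity_real (fun z => stem f p z - t0)%C r).
  cbn beta in k.
  assert (e : (stem f p z - t0)%C = 0).
  { apply k; auto.
    - intros u hu; destruct (stem_holo r f regular p u hu) as [l hl].
      eexists; exact (is_Cderive_minus _ _ _ _ _ hl (is_Cderive_const t0 u)).
    - intros t h; rewrite ht by auto; ring. }
  apply (f_equal Im) in e; revert e; generalize (stem f p z); intros [u v]; cbn; lra. }
(* Any sphere off the real axis contradicts nonconstancy; take the one through ir/2. *)
assert (hz : Cmod (0, r / 2) < r).
{ replace ((0, r / 2) : C) with (Ci * (r / 2)%R)%C by (apply injective_projections; cbn; ring).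
  rewrite Cmod_mult, Cmod_Ci, Cmod_R, Rabs_pos_eq; lra. }
assert (k := odd_part_nz (0, r / 2) hz); cbn [Im snd] in k.
specialize (k ltac:(lra)); unfold c, odd_part in k.
rewrite (const Hone w0), (const Hi w1), (const Hj w2), (const Hk w3) in k
  by (auto; intros t ht; apply (real t ht)).
assert (k' := Hmod_le_coords 0 0 0 0); rewrite !Rabs_R0 in k'; lra.
Qed.

Lemma parts_continuous z0 : Cmod z0 < r -> forall eps, 0 < eps ->
  exists delta, 0 < delta /\ forall z, Cmod (z - z0) < delta ->
    Hmod (minus (b z) (b z0)) < eps /\ Hmod (minus (c z) (c z0)) < eps.
Proof.
intros hz0 eps eps0.
assert (cont : forall p, exists delta, 0 < delta /\ forall z, Cmod (z - z0) < delta ->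
  Rabs (Re (stem f p z) - Re (stem f p z0)) < eps / 4 /\
  Rabs (Im (stem f p z) - Im (stem f p z0)) < eps / 4).
{ intros p; destruct (stem_holo r f regular p z0) as [l hl].
  { replace (z0 - 0)%C with z0 by ring; auto. }
  destruct (is_Cderive_continuous _ _ _ hl (eps / 4) ltac:(lra)) as (d & d0 & hd).
  exists d; split; auto; intros z hz; specialize (hd z hz).
  assert (m := Rmax_Cmod (stem f p z - stem f p z0)%C).
  assert (m1 := Rmax_l (Rabs (fst (stem f p z - stem f p z0)%C))
                       (Rabs (snd (stem f p z - stem f p z0)%C))).
  assert (m2 := Rmax_r (Rabs (fst (stem f p z - stem f p z0)%C))
                       (Rabs (snd (stem f p z - stem f p z0)%C))).
  split; [eapply Rle_lt_trans; [exact m1 |] | eapply Rle_lt_trans; [exact m2 |]]; lra. }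
destruct (cont Hone) as (d0 & p0 & h0); destruct (cont Hi) as (d1 & p1 & h1).
destruct (cont Hj) as (d2 & p2 & h2); destruct (cont Hk) as (d3 & p3 & h3).
exists (Rmin (Rmin d0 d1) (Rmin d2 d3)); split; [repeat apply Rmin_pos; auto |].
intros z hz.
assert (m1 := Rmin_l (Rmin d0 d1) (Rmin d2 d3)).
assert (m2 := Rmin_r (Rmin d0 d1) (Rmin d2 d3)).
assert (m3 := Rmin_l d0 d1); assert (m4 := Rmin_r d0 d1).
assert (m5 := Rmin_l d2 d3); assert (m6 := Rmin_r d2 d3).
specialize (h0 z ltac:(lra)); specialize (h1 z ltac:(lra)).
specialize (h2 z ltac:(lra)); specialize (h3 z ltac:(lra)).
split; [apply (Rle_lt_trans _ _ _ (Hmod_le_coords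
      (Re (stem f Hone z) - Re (stem f Hone z0)) (Re (stem f Hi z) - Re (stem f Hi z0))
      (Re (stem f Hj z) - Re (stem f Hj z0)) (Re (stem f Hk z) - Re (stem f Hk z0))))
  | apply (Rle_lt_trans _ _ _ (Hmod_le_coords
      (Im (stem f Hone z) - Im (stem f Hone z0)) (Im (stem f Hi z) - Im (stem f Hi z0))
      (Im (stem f Hj z) - Im (stem f Hj z0)) (Im (stem f Hk z) - Im (stem f Hk z0))))];
  lra.
Qed.

Lemma preimage_of_zero w z : Cmod z < r -> symmetrization w z = 0 ->
  exists I, imag_unit I /\ Hmult I (c z) = minus w (b z) /\ f (slice I z) = w.
Proof.
intros hz h; destruct (root_of_norm_form _ _ h) as (I & hI & e).
assert (e' : Hmult I (c z) = minus w (b z)).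
{ revert e; generalize (Hmult I (c z)) (b z); clear; Hcoords.
  intros q q'; Hcoords; Hsimpl; intros e; injection e; intros; apply H_ext; lra. }
exists I; repeat split; auto.
rewrite (slice_formula r) by auto; fold b c; rewrite e'.
generalize (b z); clear; Hring.
Qed.

Lemma zero_of_preimage I z : imag_unit I -> Cmod z < r -> symmetrization (f (slice I z)) z = 0.
Proof.
intros hI hz; apply (norm_form_of_root _ _ I hI).
rewrite (slice_formula r f regular I z hI hz); fold b c.
generalize (Hmult I (c z)) (b z); clear; Hring.
Qed.

(** A zero z of the symmetrization near z0 gives a sphere on which w is taken, at some
    unit I, and it remains to see that this I is close to I0. Both are determined by
    I c = w - b, which depends continuously on z and w as long as c is not 0; this is where
    nonconstancy on the sphere of z0 enters. If z0 is real, the whole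
    sphere is close to the point. *)
Lemma nearby_preimage I0 z0 eta : imag_unit I0 -> Cmod z0 < r -> 0 < eta ->
  exists delta, 0 < delta /\ forall (z : C) (w : H), Cmod z < r ->
    Cmod (z - z0) < delta -> Hmod (minus w (f (slice I0 z0))) < delta -> symmetrization w z = 0 ->
    exists q : H, Hmod (minus q (slice I0 z0)) < eta /\ f q = w.
Proof.
intros hI0 hz0 eta0.
destruct (Req_dec (Im z0) 0) as [real | nonreal].
- exists eta; split; auto; intros z w hz hzz _ h.
  destruct (preimage_of_zero w z hz h) as (I & hI & _ & e).
  exists (slice I z); split; auto.
  assert (k := slice_close I I0 z z0 hI); rewrite real, Rabs_R0 in k; lra.
- assert (c0 := odd_part_nz z0 hz0 nonreal).
  set (k := Rabs (Im z0) + 1); assert (k1 : 1 <= k)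
    by (unfold k; assert (t := Rabs_pos (Im z0)); lra).
  (* The first bound keeps |c z| above |c z0| / 2; the second makes |Im z0| |I - I0|,
     which is at most k 3e / (|c z0| / 2), no larger than eta / 2. *)
  set (e := Rmin (Hmod (c z0) / 2) (eta * Hmod (c z0) / (12 * k))).
  assert (epos : 0 < e).
  { apply Rmin_pos; [lra |]; apply Rdiv_lt_0_compat; nra. }
  assert (e1 := Rmin_l (Hmod (c z0) / 2) (eta * Hmod (c z0) / (12 * k))).
  assert (e2 := Rmin_r (Hmod (c z0) / 2) (eta * Hmod (c z0) / (12 * k))).
  fold e in e1, e2.
  destruct (parts_continuous z0 hz0 e epos) as (d & d0 & hd).
  exists (Rmin d (Rmin e (eta / 2))); split; [repeat apply Rmin_pos; lra |].
  intros z w hz hzz hw h.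
  assert (m1 := Rmin_l d (Rmin e (eta / 2))); assert (m2 := Rmin_r d (Rmin e (eta / 2))).
  assert (m3 := Rmin_l e (eta / 2)); assert (m4 := Rmin_r e (eta / 2)).
  destruct (hd z ltac:(lra)) as [hb hc].
  destruct (preimage_of_zero w z hz h) as (I & hI & eI & ef).
  exists (slice I z); split; auto.
  assert (eI0 := slice_formula r f regular I0 z0 hI0 hz0); fold b c in eI0.
  set (w0 := f (slice I0 z0)) in *.
  assert (diff : Hmod (Hmult (minus I I0) (c z)) <= 3 * e).
  { replace (Hmult (minus I I0) (c z)) with
      (minus (minus (minus w w0) (minus (b z) (b z0))) (Hmult I0 (minus (c z) (c z0)))).
    - eapply Rle_trans; [apply Hmod_minus |].
      rewrite Hmod_mult, (Hmod_imag_unit I0 hI0).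
      assert (t := Hmod_minus (minus w w0) (minus (b z) (b z0))).
      lra.
    - transitivity (minus (Hmult I (c z)) (Hmult I0 (c z))).
      + rewrite eI, eI0; generalize (b z) (b z0) (c z) (c z0); clear; Hring.
      + generalize (c z); clear; Hring. }
  rewrite Hmod_mult in diff.
  assert (cz : Hmod (c z0) / 2 <= Hmod (c z)).
  { assert (t := Hmod_minus (c z) (minus (c z) (c z0))).
    replace (minus (c z) (minus (c z) (c z0))) with (c z0) in t
      by (generalize (c z) (c z0); clear; Hring).
    lra. }
  assert (small : Rabs (Im z0) * Hmod (minus I I0) <= eta / 2).
  { assert (n0 := Hmod_ge_0 (minus I I0)).
    apply (Rle_trans _ (k * Hmod (minus I I0))).
    { apply Rmult_le_compat_r; auto; unfold k; lra. }
    apply (Rmult_le_reg_r (Hmod (c z0) / 2)); [lra |].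
    apply (Rle_trans _ (k * (3 * e))).
    - rewrite Rmult_assoc; apply Rmult_le_compat_l; nra.
    - apply (Rle_trans _ (k * (3 * (eta * Hmod (c z0) / (12 * k))))).
      + apply Rmult_le_compat_l; lra.
      + right; field; lra. }
  assert (t := slice_close I I0 z z0 hI); lra.
Qed.

(** The neighbourhood of z0 does not depend on mu: the radius of the circle in the
    perturbation argument is chosen first, and mu comes from it. *)
Lemma symmetrization_shift_small (z0 : C) (w0 : H) : Cmod z0 < r ->
  exists delta, 0 < delta /\ forall mu, 0 < mu -> exists eps, 0 < eps /\
    forall (z : C) (w : H), Cmod (z - z0) < delta -> Hmod (minus w w0) < eps ->
      Cmod (symmetrization w z - symmetrization w0 z) < mu.
Proof.
intros hz0.
destruct (parts_continuous z0 hz0 1 Rlt_0_1) as (d & d0 & hd).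
set (K := 2 * (Hmod (b z0) + 1 + Hmod w0) + 1 + 2 * (Hmod (c z0) + 1)).
assert (b0 := Hmod_ge_0 (b z0)); assert (c0 := Hmod_ge_0 (c z0)).
assert (w00 := Hmod_ge_0 w0).
assert (K0 : 0 < K) by (unfold K; lra).
exists d; split; auto; intros mu mu0.
exists (Rmin 1 (mu / K)); split.
{ apply Rmin_pos; [lra | apply Rdiv_lt_0_compat; lra]. }
intros z w hz hw.
assert (m3 := Rmin_l 1 (mu / K)); assert (m4 := Rmin_r 1 (mu / K)).
destruct (hd z ltac:(lra)) as [hb hc].
assert (s := norm_form_shift (minus (b z) w0) (minus w0 w) (c z)).
assert (split_w : minus (b z) w = plus (minus (b z) w0) (minus w0 w))
  by (generalize (b z); clear; Hring).
replace (Hmod (minus w0 w)) with (Hmod (minus w w0)) in s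
  by (rewrite <- Hmod_opp; f_equal; clear; Hring).
assert (tb := Hmod_le_minus (b z) (b z0)); assert (tc := Hmod_le_minus (c z) (c z0)).
assert (tw := Hmod_minus (b z) w0).
assert (n0 := Hmod_ge_0 (minus w w0)).
unfold symmetrization; rewrite split_w; apply (Rle_lt_trans _ _ _ s), (Rle_lt_trans _ (Hmod (minus w w0) * K)).
- apply Rmult_le_compat_l; auto; unfold K; lra.
- apply (Rlt_le_trans _ (mu / K * K)); [apply Rmult_lt_compat_r; lra |].
  right; field; lra.
Qed.

(** The symmetrization of f - w0 has an isolated zero at z0. On a small circle around z0
    its modulus is at least 2 mu, and passing from w0 to a nearby w changes it by less than
    mu; hence the symmetrization of f - w has a zero inside the circle. *)
Lemma image_contains_ball I0 z0 eta : imag_unit I0 -> Cmod z0 < r -> 0 < eta ->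
  exists eps, 0 < eps /\ forall w : H, Hmod (minus w (f (slice I0 z0))) < eps ->
    exists q : H, Hmod (minus q (slice I0 z0)) < eta /\ f q = w.
Proof.
intros hI0 hz0 eta0; set (w0 := f (slice I0 z0)).
destruct (nearby_preimage I0 z0 eta hI0 hz0 eta0) as (d1 & d1pos & near).
fold w0 in near.
assert (z00 := Cmod_ge_0 z0).
set (R1 := Rmin d1 (r - Cmod z0)); assert (R1pos : 0 < R1) by (apply Rmin_pos; [exact d1pos | lra]).
assert (n1 := Rmin_l d1 (r - Cmod z0)); assert (n2 := Rmin_r d1 (r - Cmod z0)).
fold R1 in n1, n2.
assert (sub : forall w, holo_on_disc (symmetrization w) z0 R1).
{ intros w; apply (holo_sub_disc _ r); [apply symmetrization_holo | lra]. }
destruct (isolated_zero (symmetrization w0) z0 R1 (sub w0)) as [zero | (m & be & d2 & be0 & d2pos & low)].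
{ destruct (symmetrization_not_vanishing w0 z0 hz0); exists R1; auto. }
destruct (symmetrization_shift_small z0 w0 hz0) as (d3 & d3pos & shift).
set (s := Rmin R1 (Rmin d2 d3)).
assert (s0 : 0 < s) by (apply Rmin_pos; [exact R1pos | apply Rmin_pos; auto]).
assert (n3 := Rmin_l R1 (Rmin d2 d3)); assert (n4 := Rmin_r R1 (Rmin d2 d3)).
assert (n5 := Rmin_l d2 d3); assert (n6 := Rmin_r d2 d3); fold s in n3, n4.
set (mu := be * (s / 2) ^ m / 2).
assert (mu0 : 0 < mu).
{ unfold mu; assert (t := pow_lt (s / 2) m ltac:(lra)).
  assert (0 < be * (s / 2) ^ m) by (apply Rmult_lt_0_compat; auto); lra. }
destruct (shift mu mu0) as (d4 & d4pos & close).
exists (Rmin d1 d4); split; [apply Rmin_pos; auto |]; intros w hw.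
assert (n7 := Rmin_l d1 d4); assert (n8 := Rmin_r d1 d4).
assert (cc : Cmod (z0 - z0) = 0)
  by (replace (z0 - z0)%C with (RtoC 0) by ring; apply Cmod_0).
destruct (zero_in_disc (symmetrization w) z0 R1 (s / 2) mu (sub w) ltac:(lra)) as (z & hz & h).
- intros z hz.
  assert (k := close z w ltac:(lra) ltac:(lra)).
  assert (l := low z ltac:(lra)); rewrite hz in l.
  assert (t := Cmod_triangle (symmetrization w z) (- (symmetrization w z - symmetrization w0 z))).
  replace (symmetrization w z + - (symmetrization w z - symmetrization w0 z))%C with (symmetrization w0 z) in t by ring.
  rewrite Cmod_opp in t; unfold mu in *; lra.
- assert (k := close z0 w ltac:(lra) ltac:(lra)).
  unfold w0 in k; rewrite (zero_of_preimage I0 z0 hI0 hz0) in k.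
  replace (symmetrization w z0 - 0)%C with (symmetrization w z0) in k by ring; exact k.
- apply (near z w); auto; try lra.
  replace z with ((z - z0) + z0)%C by ring.
  eapply Rle_lt_trans; [apply Cmod_triangle |]; lra.
Qed.

End Openness.

Theorem corollary1p5 :
  forall (r : R) (f : H -> H),
    0 < r ->
    regular_on (Hball r) f ->
    (forall x y : R, y <> 0 ->
       (forall q : H, sphere x y q -> Hball r q) ->
       ~ constant_on (sphere x y) f) ->
    forall U : H -> Prop,
      (forall q : H, U q -> Hball r q) -> open U -> open (image f U).
Proof.
intros r f r0 regular nonconstant U hU openU w0 (q0 & hq0 & <-).
destruct (slice_decomposition q0) as (I0 & z0 & hI0 & ->).
assert (hz0 : Cmod z0 < r).
{ rewrite <- (Hmod_slice I0) by auto; exact (hU _ hq0). }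
destruct (openU _ hq0) as [eta hU'].
destruct (image_contains_ball r f regular r0 nonconstant I0 z0 eta hI0 hz0 (cond_pos eta))
  as (eps & eps0 & hw).
assert (eps4 : 0 < eps / 4) by lra.
exists (mkposreal _ eps4); intros w hball.
destruct (hw w) as (q & hq & e).
- apply (Rlt_le_trans _ _ _ (Hmod_lt_of_ball _ _ _ hball)).
  change (4 * (eps / 4) <= eps); lra.
- exists q; split; [| exact e].
  apply hU', H_ball_of_Hmod, hq.
Qed.
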